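(* Let $(M,\omega,\theta)$ be a locally conformally symplectic manifold and let $(\pi,\xi)$ be the associated Jacobi structure. Then the skew algebroid $(T^*M,\sharp_{\pi,\xi},[\cdot,\cdot]_{\pi,\xi}^{\theta})$ is a Lie algebroid isomorphic to the tangent algebroid $(TM,\mathrm{id},[\cdot,\cdot])$ of $M$.
   Context: A locally conformally symplectic structure on a smooth manifold $M$ is a pair $(\omega,\theta)$ of a nondegenerate $2$-form $\omega$ and a closed $1$-form $\theta$ with $d\omega+\theta\wedge\omega=0$. The associated Jacobi structure $(\pi,\xi)$ (bivector field, vector field) is defined by $i_{\sharp_\pi(\alpha)}\omega=-\alpha$ for all $\alpha\in\Omega^1(M)$ and $i_\xi\omega=-\theta$, where $\sharp_\pi:T^*M\to TM$ is given by $\beta(\sharp_\pi(\alpha))=\pi(\alpha,\beta)$. (Jacobi structure means: $[\pi,\pi]=2\xi\wedge\pi$ and $\mathcal{L}_\xi\pi=0$, for the Schouten-Nijenhuis bracket.) A skew algebroid over $M$ is a triple $(E,\sharp_E,[\cdot,\cdot]_E)$ with $E\to M$ a vector bundle, $\sharp_E:E\to TM$ a vector bundle morphism (the anchor), and $[\cdot,\cdot]_E$ an alternating $\mathbb{R}$-bilinear bracket on $\Gamma(E)$ with $[s,\varphi t]_E=\varphi[s,t]_E+\sharp_E(s)(\varphi)\,t$ for $\varphi\in C^\infty(M)$. It is a Lie algebroid if $[\cdot,\cdot]_E$ satisfies the Jacobi identity. Define $[\alpha,\beta]_\pi=\mathcal{L}_{\sharp_\pi(\alpha)}\beta-\mathcal{L}_{\sharp_\pi(\beta)}\alpha-d(\pi(\alpha,\beta))$,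 $\sharp_{\pi,\xi}(\alpha)=\sharp_\pi(\alpha)+\alpha(\xi)\xi$, and, for $\lambda\in\Omega^1(M)$, $$[\alpha,\beta]_{\pi,\xi}^{\lambda}=[\alpha,\beta]_\pi+\alpha(\xi)(\mathcal{L}_\xi\beta-\beta)-\beta(\xi)(\mathcal{L}_\xi\alpha-\alpha)-\pi(\alpha,\beta)\lambda.$$ The triple $(T^*M,\sharp_{\pi,\xi},[\cdot,\cdot]_{\pi,\xi}^{\lambda})$ is a skew algebroid. *)

(* Defs.v *)
From HB Require Import structures.
From mathcomp Require Import all_boot all_order all_algebra.
From mathcomp Require Import boolp classical_sets functions reals.
From mathcomp Require Import topology normedtype derive.

Set Implicit Arguments.
Unset Strict Implicit.
Unset Printing Implicit Defensive.
Import Order.TTheory GRing.Theory Num.Theory.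
Import numFieldNormedType.Exports.
Local Open Scope classical_set_scope.
Local Open Scope ring_scope.

(* [U] is meant to be open; since the source is finite-dimensional, requiring
   all directional derivatives to be C^k amounts to the differential being C^k. *)
Fixpoint Ck_on (R : realType) (n : nat) (W : normedModType R) (k : nat)
    (U : set 'rV[R]_n) (f : 'rV[R]_n -> W) : Prop :=
  match k with
  | 0 => forall u, U u -> {for u, continuous f}
  | k'.+1 => (forall u, U u -> differentiable f u) /\
             (forall v, Ck_on k' U (fun u => 'D_v f u))
  end.

Definition smooth_on (R : realType) (n : nat) (W : normedModType R)
    (U : set 'rV[R]_n) (f : 'rV[R]_n -> W) : Prop :=
  forall k, Ck_on k U f.

(* Smooth manifolds of dimension [n], given by a (not necessarily maximal)
   smooth atlas. The chart [i] is the homeomorphism [chart_map i] from the open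
   set [dom i] onto an open subset of R^n, with inverse [chartV i]; the values
   of [chart_map i] and [chartV i] elsewhere are irrelevant. As part of the
   data, every point has a preferred chart [chart_at x] around it. *)
Record manifold (R : realType) (n : nat) := Manifold {
  mpoint :> topologicalType ;
  manifold_hausdorff : hausdorff_space mpoint ;
  manifold_second_countable : @second_countable mpoint ;
  chart : Type ;
  dom : chart -> set mpoint ;
  chart_map : chart -> mpoint -> 'rV[R]_n ;
  chartV : chart -> 'rV[R]_n -> mpoint ;
  chart_at : mpoint -> chart ;
  dom_chart_at : forall x, dom (chart_at x) x ;
  open_dom : forall i, open (dom i) ;
  open_codom : forall i, open (chart_map i @` dom i) ;
  chart_mapK : forall i x, dom i x -> chartV i (chart_map i x) = x ;
  chart_map_continuous : forall i x, dom i x ->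
    {for x, continuous (chart_map i)} ;
  chartV_continuous : forall i u, (chart_map i @` dom i) u ->
    {for u, continuous (chartV i)} ;
  chart_change_smooth : forall i j,
    smooth_on (chart_map i @` (dom i `&` dom j)) (chart_map j \o chartV i)
}.

Definition msmooth_on (R : realType) (n : nat) (M : manifold R n)
    (W : normedModType R) (U : set M) (f : M -> W) : Prop :=
  forall i, smooth_on (chart_map i @` (U `&` dom i)) (f \o chartV i).

Definition msmooth (R : realType) (n : nat) (M : manifold R n)
    (W : normedModType R) (f : M -> W) : Prop :=
  msmooth_on [set: M] f.

(* Row [k] of [jac i j x] is the derivative of the coordinates [chart_map j]
   along the [k]-th coordinate of [chart_map i]. *)
Definition jac (R : realType) (n : nat) (M : manifold R n) (i j : chart M)
    (x : M) : 'M[R]_n :=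
  'J (chart_map j \o chartV i) (chart_map i x).

(* Fibers and local trivializations [triv t x : E_x -> R^r] for
   [x] in [tdom t]; the axioms are stated in [is_vbundle]. *)
Record vbundle (R : realType) (n : nat) (M : manifold R n) := VBundle {
  vb_rank : nat ;
  fiber :> M -> lmodType R ;
  tindex : Type ;
  tdom : tindex -> set M ;
  triv : tindex -> forall x, fiber x -> 'rV[R]_vb_rank
}.

Definition is_vbundle (R : realType) (n : nat) (M : manifold R n)
    (E : vbundle M) : Prop :=
  [/\ forall t : tindex E, open (tdom t),
      forall x, exists t : tindex E, tdom t x,
      forall (t : tindex E) x, tdom t x ->
        linear (@triv _ _ _ E t x) /\ bijective (@triv _ _ _ E t x) &
      forall t s : tindex E,
        exists2 g : M -> 'M[R]_(vb_rank E), msmooth_on (tdom t `&` tdom s) g &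
          forall x (e : E x), tdom t x -> tdom s x ->
            triv s e = triv t e *m g x].

(* Not necessarily smooth sections. *)
Definition msection (R : realType) (n : nat) (M : manifold R n)
    (E : vbundle M) := forall x, E x.

Definition smooth_section (R : realType) (n : nat) (M : manifold R n)
    (E : vbundle M) (s : msection E) : Prop :=
  forall t : tindex E, msmooth_on (tdom t) (fun x => triv t (s x)).

(* Morphisms over the identity of [M]. *)
Definition vb_morphism (R : realType) (n : nat) (M : manifold R n)
    (E F : vbundle M) (f : forall x, E x -> F x) : Prop :=
  (forall x, linear (f x)) /\
  forall (t : tindex E) (s : tindex F),
    exists2 g : M -> 'M[R]_(vb_rank E, vb_rank F),
      msmooth_on (tdom t `&` tdom s) g &
      forall x (e : E x), tdom t x -> tdom s x ->
        triv s (f x e) = triv t e *m g x.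

(* Tensors at [x] are identified with their components in the preferred chart
   [chart_at x]: T_xM is the space of row vectors, T*_xM the space of column
   vectors, bilinear forms on T_xM and on T*_xM are square matrices. *)

Definition vcomp (R : realType) (n : nat) (M : manifold R n) (i : chart M)
    (X : M -> 'rV[R]_n) : M -> 'rV[R]_n :=
  fun x => X x *m jac (chart_at x) i x.

Definition fcomp (R : realType) (n : nat) (M : manifold R n) (i : chart M)
    (a : M -> 'cV[R]_n) : M -> 'cV[R]_n :=
  fun x => jac i (chart_at x) x *m a x.

Definition f2comp (R : realType) (n : nat) (M : manifold R n) (i : chart M)
    (w : M -> 'M[R]_n) : M -> 'M[R]_n :=
  fun x => jac i (chart_at x) x *m w x *m (jac i (chart_at x) x)^T.

Definition v2comp (R : realType) (n : nat) (M : manifold R n) (i : chart M)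
    (p : M -> 'M[R]_n) : M -> 'M[R]_n :=
  fun x => (jac (chart_at x) i x)^T *m p x *m jac (chart_at x) i x.

Definition tangent (R : realType) (n : nat) (M : manifold R n) : vbundle M :=
  @VBundle R n M n (fun=> 'rV[R]_n : lmodType R) (chart M) (@dom _ _ M)
    (fun i x v => v *m jac (chart_at x) i x).

Definition cotangent (R : realType) (n : nat) (M : manifold R n) : vbundle M :=
  @VBundle R n M n (fun=> 'cV[R]_n : lmodType R) (chart M) (@dom _ _ M)
    (fun i x a => (jac i (chart_at x) x *m a)^T).

(* The value a(v) of a covector on a vector. *)
Definition pairing (R : realType) (n : nat) (a : 'cV[R]_n) (v : 'rV[R]_n) : R :=
  (v *m a) 0 0.

(* The value w(v, v') of a bilinear form on vectors. *)
Definition ev2 (R : realType) (n : nat) (w : 'M[R]_n) (v v' : 'rV[R]_n) : R :=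
  (v *m w *m v'^T) 0 0.

(* The value p(a, b) of a bilinear form on covectors. *)
Definition cev2 (R : realType) (n : nat) (p : 'M[R]_n) (a b : 'cV[R]_n) : R :=
  (a^T *m p *m b) 0 0.

Definition vector_field (R : realType) (n : nat) (M : manifold R n)
    (X : M -> 'rV[R]_n) : Prop :=
  @smooth_section R n M (tangent M) X.

Definition form1 (R : realType) (n : nat) (M : manifold R n)
    (a : M -> 'cV[R]_n) : Prop :=
  @smooth_section R n M (cotangent M) a.

Definition form2 (R : realType) (n : nat) (M : manifold R n)
    (w : M -> 'M[R]_n) : Prop :=
  (forall x v, ev2 (w x) v v = 0) /\
  (forall i, msmooth_on (dom i) (f2comp i w)).

Definition bivector_field (R : realType) (n : nat) (M : manifold R n)
    (p : M -> 'M[R]_n) : Prop :=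
  (forall x a, cev2 (p x) a a = 0) /\
  (forall i, msmooth_on (dom i) (v2comp i p)).

(* The operators below are given at [x] by their coordinate formulas in the
   preferred chart [chart_at x]; on smooth fields they do not depend on it. *)

(* Derivative at [x] along [v] in T_xM; for real-valued [f] this is v(f). *)
Definition deriv_at (R : realType) (n : nat) (M : manifold R n)
    (W : normedModType R) (x : M) (v : 'rV[R]_n) (f : M -> W) : W :=
  'D_v (f \o chartV (chart_at x)) (chart_map (chart_at x) x).

Definition lie_bracket (R : realType) (n : nat) (M : manifold R n)
    (X Y : M -> 'rV[R]_n) : M -> 'rV[R]_n :=
  fun x => deriv_at x (X x) (vcomp (chart_at x) Y)
         - deriv_at x (Y x) (vcomp (chart_at x) X).

Definition ext_d0 (R : realType) (n : nat) (M : manifold R n)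
    (f : M -> R) : M -> 'cV[R]_n :=
  fun x => \col_k deriv_at x (delta_mx 0 k) (f : M -> R^o).

(* (dt)(v, w) = (D_v t)(w) - (D_w t)(v) in coordinates *)
Definition ext_d1 (R : realType) (n : nat) (M : manifold R n)
    (t : M -> 'cV[R]_n) (x : M) (v w : 'rV[R]_n) : R :=
  pairing (deriv_at x v (fcomp (chart_at x) t)) w
  - pairing (deriv_at x w (fcomp (chart_at x) t)) v.

Definition ext_d2 (R : realType) (n : nat) (M : manifold R n)
    (w : M -> 'M[R]_n) (x : M) (v0 v1 v2 : 'rV[R]_n) : R :=
  ev2 (deriv_at x v0 (f2comp (chart_at x) w)) v1 v2
  - ev2 (deriv_at x v1 (f2comp (chart_at x) w)) v0 v2
  + ev2 (deriv_at x v2 (f2comp (chart_at x) w)) v0 v1.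

Definition wedge12 (R : realType) (n : nat) (t : 'cV[R]_n) (w : 'M[R]_n)
    (v0 v1 v2 : 'rV[R]_n) : R :=
  pairing t v0 * ev2 w v1 v2 - pairing t v1 * ev2 w v0 v2
  + pairing t v2 * ev2 w v0 v1.

(* (L_X b)_k = X^j d_j b_k + b_j d_k X^j in coordinates *)
Definition lie_form (R : realType) (n : nat) (M : manifold R n)
    (X : M -> 'rV[R]_n) (b : M -> 'cV[R]_n) : M -> 'cV[R]_n :=
  fun x => deriv_at x (X x) (fcomp (chart_at x) b)
    + \col_k pairing (b x) (deriv_at x (delta_mx 0 k) (vcomp (chart_at x) X)).

Record algebroid (R : realType) (n : nat) (M : manifold R n) := Algebroid {
  abundle : vbundle M ;
  anchor : forall x, abundle x -> tangent M x ;
  abracket : msection abundle -> msection abundle -> msection abundle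
}.

Record is_skew_algebroid (R : realType) (n : nat) (M : manifold R n)
    (A : algebroid M) : Prop := IsSkewAlgebroid {
  skew_vbundle : is_vbundle (abundle A) ;
  skew_anchor : vb_morphism (@anchor _ _ _ A) ;
  skew_closed : forall s t : msection (abundle A),
    smooth_section s -> smooth_section t -> smooth_section (abracket s t) ;
  skew_alternating : forall s : msection (abundle A), smooth_section s ->
    forall x, abracket s s x = 0 ;
  skew_linearl : forall (c : R) (s s' t : msection (abundle A)),
    smooth_section s -> smooth_section s' -> smooth_section t -> forall x,
      abracket (fun y => c *: s y + s' y) t x
      = c *: abracket s t x + abracket s' t x ;
  skew_linearr : forall (c : R) (s t t' : msection (abundle A)),
    smooth_section s -> smooth_section t -> smooth_section t' -> forall x,
      abracket s (fun y => c *: t y + t' y) x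
      = c *: abracket s t x + abracket s t' x ;
  skew_leibniz : forall (phi : M -> R) (s t : msection (abundle A)),
    msmooth (phi : M -> R^o) -> smooth_section s -> smooth_section t ->
    forall x,
      abracket s (fun y => phi y *: t y) x
      = phi x *: abracket s t x
        + deriv_at x (anchor (s x)) (phi : M -> R^o) *: t x
}.

Definition is_lie_algebroid (R : realType) (n : nat) (M : manifold R n)
    (A : algebroid M) : Prop :=
  is_skew_algebroid A /\
  forall s t u : msection (abundle A),
    smooth_section s -> smooth_section t -> smooth_section u -> forall x,
      abracket s (abracket t u) x + abracket t (abracket u s) x
      + abracket u (abracket s t) x = 0.

Definition algebroid_iso (R : realType) (n : nat) (M : manifold R n)
    (A B : algebroid M) : Prop :=
  exists (f : forall x, abundle A x -> abundle B x)
         (g : forall x, abundle B x -> abundle A x),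
    [/\ vb_morphism f, vb_morphism g,
        forall x, cancel (f x) (g x) /\ cancel (g x) (f x),
        forall x (e : abundle A x), anchor (f x e) = anchor e &
        forall s t : msection (abundle A), smooth_section s ->
          smooth_section t -> forall x,
          f x (abracket s t x)
          = abracket (fun y => f y (s y)) (fun y => f y (t y)) x].

Definition tangent_algebroid (R : realType) (n : nat) (M : manifold R n) :
    algebroid M :=
  @Algebroid R n M (tangent M) (fun x v => v) (@lie_bracket R n M).

Definition nondegenerate2 (R : realType) (n : nat) (M : manifold R n)
    (w : M -> 'M[R]_n) : Prop :=
  forall x v, (forall v', ev2 (w x) v v' = 0) -> v = 0.

Definition is_lcs (R : realType) (n : nat) (M : manifold R n)
    (omega : M -> 'M[R]_n) (theta : M -> 'cV[R]_n) : Prop :=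
  [/\ form2 omega, nondegenerate2 omega, form1 theta,
      forall x v w, ext_d1 theta x v w = 0 &
      forall x v0 v1 v2, ext_d2 omega x v0 v1 v2
        + wedge12 (theta x) (omega x) v0 v1 v2 = 0].

(* See [pairing_sharp] for the characterization of [sharp]. *)
Definition sharp (R : realType) (n : nat) (p : 'M[R]_n) (a : 'cV[R]_n) :
    'rV[R]_n := a^T *m p.

Lemma pairing_sharp (R : realType) (n : nat) (p : 'M[R]_n) (a b : 'cV[R]_n) :
  pairing b (sharp p a) = cev2 p a b.
Proof. by []. Qed.

Definition is_assoc_jacobi (R : realType) (n : nat) (M : manifold R n)
    (omega : M -> 'M[R]_n) (theta : M -> 'cV[R]_n)
    (p : M -> 'M[R]_n) (xi : M -> 'rV[R]_n) : Prop :=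
  [/\ bivector_field p, vector_field xi,
      forall x (a : 'cV[R]_n) v,
        ev2 (omega x) (sharp (p x) a) v = - pairing a v &
      forall x v, ev2 (omega x) (xi x) v = - pairing (theta x) v].

Definition bracket_bivector (R : realType) (n : nat) (M : manifold R n)
    (p : M -> 'M[R]_n) (a b : M -> 'cV[R]_n) : M -> 'cV[R]_n :=
  fun x => lie_form (fun y => sharp (p y) (a y)) b x
         - lie_form (fun y => sharp (p y) (b y)) a x
         - ext_d0 (fun y => cev2 (p y) (a y) (b y)) x.

Definition sharp_jacobi (R : realType) (n : nat) (M : manifold R n)
    (p : M -> 'M[R]_n) (xi : M -> 'rV[R]_n) (x : M) (a : 'cV[R]_n) :
    'rV[R]_n :=
  sharp (p x) a + pairing a (xi x) *: xi x.

Definition bracket_jacobi (R : realType) (n : nat) (M : manifold R n)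
    (p : M -> 'M[R]_n) (xi : M -> 'rV[R]_n) (lambda : M -> 'cV[R]_n)
    (a b : M -> 'cV[R]_n) : M -> 'cV[R]_n :=
  fun x => bracket_bivector p a b x
    + pairing (a x) (xi x) *: (lie_form xi b x - b x)
    - pairing (b x) (xi x) *: (lie_form xi a x - a x)
    - cev2 (p x) (a x) (b x) *: lambda x.

Definition jacobi_algebroid (R : realType) (n : nat) (M : manifold R n)
    (p : M -> 'M[R]_n) (xi : M -> 'rV[R]_n) (lambda : M -> 'cV[R]_n) :
    algebroid M :=
  @Algebroid R n M (cotangent M) (sharp_jacobi p xi)
    (bracket_jacobi p xi lambda).

(* Main.v *)
From HB Require Import structures.
Require Import Defs.
From mathcomp Require Import all_boot all_order all_algebra.
From mathcomp Require Import ring lra.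
From mathcomp Require Import boolp classical_sets functions reals.
From mathcomp Require Import topology normedtype landau derive sesquilinear.

(** The anchor [sharp_jacobi p xi] is invertible, with inverse
    v |-> theta(v) theta - i_v omega, because xi = sharp_p theta and
    theta(xi) = 0. It intertwines the two brackets: for X = sharp a + a(xi) xi
    and Y = sharp b + b(xi) xi one has a(xi) = - theta(X) and
    p(a, b) = omega(X, Y), and Cartan's formula
    i_[X, Y] omega
      = L_X i_Y omega - L_Y i_X omega + d(omega(X, Y)) - i_Y i_X d omega
    combined with d omega = - theta /\ omega and d theta = 0 turns
    theta([X, Y]) theta - i_[X, Y] omega into the Jacobi bracket of a and b.
    All the axioms of a Lie algebroid are then transported from TM. There, since
    the bracket at x is defined in the preferred chart at x, smoothness and the
    Jacobi identity require invariance of the Lie bracket under chart changes,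
    which rests on the symmetry of second derivatives. *)

Set Implicit Arguments.
Unset Strict Implicit.
Unset Printing Implicit Defensive.
Import Order.TTheory GRing.Theory Num.Theory.
Import numFieldNormedType.Exports.
Local Open Scope classical_set_scope.
Local Open Scope ring_scope.

(** * Differential calculus *)

(** Why lambda = theta: the terms of the bracket without derivatives, -a(xi) b + b(xi) a - p(a, b)
    theta, take on a vector z the value -(theta /\ omega)(X, Y, z), because a(xi) = -theta(X), b(xi)
    = -theta(Y) and the products theta(X) theta(Y) theta(z) cancel. By the structure equation this
    is d omega(X, Y, z), exactly the last term that Cartan's formula asks for. The encoding shapes
    the rest. A field is stored through its components in the preferred chart of each point, and
    that chart may jump from point to point, so the stored function itself need not be smooth. Every
    derivative is therefore taken of the components in one fixed chart, and identities on the
    manifold are first turned into identities near a point of R^n. For the cotangent bracket a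
    comparison at x in the chart at x suffices, since its smoothness and its Jacobi identity arrive
    by transport. *)

Lemma scale_bilinear (R : realType) (W : normedModType R) :
  bilinear_for (GRing.Scale.Law.clone _ _ *:%R _)
    (GRing.Scale.Law.clone _ _ *:%R _) (@GRing.scale R W : R^o -> W -> W).
Proof.
split=> [w|r] a x y /=; first by rewrite scalerDl -scalerA.
by rewrite scalerDr !scalerA mulrC.
Qed.

HB.instance Definition _ (R : realType) (W : normedModType R) :=
  bilinear_isBilinear.Build R R^o W W _ _ (@GRing.scale R W : R^o -> W -> W)
    (@scale_bilinear R W).

Lemma continuous_sum_fun (R : realType) (T : topologicalType)
    (W : normedModType R) (I : Type) (r : seq I) (f : I -> T -> W) (x : T) :
  (forall i, {for x, continuous (f i)}) ->
  {for x, continuous (fun y => \sum_(i <- r) f i y)}.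
Proof.
move=> fc; elim: r => [|i r IH].
  rewrite (_ : (fun y => _) = cst 0); first exact: cst_continuous.
  by apply/funext => y; rewrite big_nil.
rewrite (_ : (fun y => _) = f i \+ (fun y => \sum_(j <- r) f j y)).
  exact: continuousD.
by apply/funext => y; rewrite big_cons.
Qed.

(** The source is finite-dimensional: expanding the argument in the basis [delta_mx i j] leaves
    coordinate functions times fixed vectors. *)
Lemma linear_mx_continuous (R : realType) (m n : nat) (W : normedModType R)
    (f : {linear 'M[R]_(m, n) -> W}) : continuous f.
Proof.
move=> x.
have -> : (f : _ -> _) = (fun y : 'M[R]_(m, n) =>
    \sum_i (\sum_j y i j *: f (delta_mx i j))).
  apply/funext => y; rewrite {1}[y]matrix_sum_delta linear_sum.
  by apply: eq_bigr => i _; rewrite linear_sum; apply: eq_bigr => j _; rewrite linearZ.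
apply: continuous_sum_fun => i; apply: continuous_sum_fun => j.
apply: continuousZr_tmp; exact: coord_continuous.
Qed.

(** Joint continuity. Only the left factor is expanded in the basis; each summand is then a
    coordinate times a linear image of the right factor. *)
Lemma mulmx_continuous (R : realType) (m n p : nat) :
  continuous (fun q : 'M[R]_(m, n) * 'M[R]_(n, p) => q.1 *m q.2).
Proof.
move=> q.
have -> : (fun q : 'M[R]_(m, n) * 'M[R]_(n, p) => q.1 *m q.2) =
    (fun q => \sum_i \sum_j q.1 i j *: (delta_mx i j *m q.2)).
  apply/funext => -[A B] /=; rewrite {1}[A]matrix_sum_delta mulmx_suml.
  by apply: eq_bigr => i _; rewrite mulmx_suml; apply: eq_bigr => j _; rewrite scalemxAl.
apply: continuous_sum_fun => i; apply: continuous_sum_fun => j.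
apply: continuousZ.
  apply: (@continuous_comp _ _ _ fst (fun A : 'M_(m, n) => A i j)).
    exact: cvg_fst.
  exact: coord_continuous.
apply: (@continuous_comp _ _ 'M[R]_(m, p) snd
  (fun A : 'M[R]_(n, p) => delta_mx i j *m A)); first exact: cvg_snd.
exact: (@linear_mx_continuous R n p _ (mulmx (delta_mx i j))).
Qed.

Lemma differentiable_near_eq (R : realType) (V W : normedModType R)
    (f g : V -> W) (x : V) :
  {near x, f =1 g} -> differentiable f x -> differentiable g x.
Proof.
move=> fg /diff_locallyP[dfc dfx].
have dgx : g \o shift x = cst (g x) + 'd f x +o_ (0 : V) id.
  apply/eqaddoP => e e0; have /eqaddoP/(_ e e0) := dfx.
  have fg0 : \forall h \near (0 : V), f (h + x) = g (h + x).
    by move: fg; rewrite (near_shift 0) /= subr0; apply: filterS => h ->.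
  apply: filterS2 fg0 => h fgh; rewrite !fctE /=.
  by rewrite -fgh -(nbhs_singleton fg).
(* ['d g x] is picked by a choice operator, so the expansion of [g] just obtained must first
   identify it with ['d f x]. *)
have dE : 'd g x = 'd f x :> (V -> W) by exact: diff_unique.
by apply/diff_locallyP; rewrite dE.
Qed.

(** One product rule for all products used below: [mulmx], and scaling seen as a bilinear map on
    [R^o]. *)
Lemma diff_bilin_comp (R : realType) (V W1 W2 W : normedModType R)
    (b : {bilinear W1 -> W2 -> W}) (f : V -> W1) (g : V -> W2) (x : V) :
  continuous (fun p => b p.1 p.2) -> differentiable f x -> differentiable g x ->
  differentiable (fun y => b (f y) (g y)) x /\
  forall v, 'D_v (fun y => b (f y) (g y)) x = b ('D_v f x) (g x) + b (f x) ('D_v g x).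
Proof.
move=> bc df dg.
have dfg := differentiable_pair df dg.
have db := differentiable_bilin (f x, g x) bc.
have dbfg := differentiable_comp dfg db; split => [|v]; first exact: dbfg.
rewrite (deriveE v dbfg) (diff_comp dfg db) /= diff_bilin // diff_pair //=.
by rewrite -!deriveE // addrC.
Qed.

Lemma differentiable_mulmx (R : realType) (V : normedModType R) (m n p : nat)
    (f : V -> 'M[R]_(m, n)) (g : V -> 'M[R]_(n, p)) (x : V) :
  differentiable f x -> differentiable g x ->
  differentiable (fun y => f y *m g y) x.
Proof.
by move=> df dg; have [] := diff_bilin_comp (@mulmx_continuous R m n p) df dg.
Qed.

Lemma derive_mulmx (R : realType) (V : normedModType R) (m n p : nat)
    (f : V -> 'M[R]_(m, n)) (g : V -> 'M[R]_(n, p)) (x v : V) :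
  differentiable f x -> differentiable g x ->
  'D_v (fun y => f y *m g y) x = 'D_v f x *m g x + f x *m 'D_v g x.
Proof.
by move=> df dg; have [_] := diff_bilin_comp (@mulmx_continuous R m n p) df dg; apply.
Qed.

Lemma differentiable_scale (R : realType) (V W : normedModType R)
    (k : V -> R^o) (f : V -> W) (x : V) :
  differentiable k x -> differentiable f x ->
  differentiable (fun y => k y *: f y) x.
Proof.
by move=> dk df; have [] := diff_bilin_comp (@scale_continuous R W) dk df.
Qed.

Lemma derive_scale (R : realType) (V W : normedModType R)
    (k : V -> R^o) (f : V -> W) (x v : V) :
  differentiable k x -> differentiable f x ->
  'D_v (fun y => k y *: f y) x = 'D_v k x *: f x + k x *: 'D_v f x.
Proof.
by move=> dk df; have [_] := diff_bilin_comp (@scale_continuous R W) dk df; apply.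
Qed.

Lemma differentiable_linear_comp (R : realType) (V W W' : normedModType R)
    (L : {linear W -> W'}) (f : V -> W) (x : V) :
  continuous L -> differentiable f x -> differentiable (fun y => L (f y)) x.
Proof.
by move=> Lc df; apply: differentiable_comp => //; exact: linear_differentiable.
Qed.

Lemma derive_linear_comp (R : realType) (V W W' : normedModType R)
    (L : {linear W -> W'}) (f : V -> W) (x v : V) :
  continuous L -> differentiable f x ->
  'D_v (fun y => L (f y)) x = L ('D_v f x).
Proof.
move=> Lc df; rewrite deriveE; last exact: differentiable_linear_comp.
have dL : differentiable L (f x) by exact: linear_differentiable.
by rewrite (diff_comp df dL) /= diff_lin // deriveE.
Qed.

Lemma derive_linear_dir (R : realType) (V W : normedModType R) (f : V -> W)
    (x : V) : differentiable f x -> linear (fun v => 'D_v f x).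
Proof. by move=> df c v w; rewrite !deriveE // linearP. Qed.

Lemma derive_comp (R : realType) (U V W : normedModType R) (f : U -> V)
    (g : V -> W) (x v : U) :
  differentiable f x -> differentiable g (f x) ->
  'D_v (g \o f) x = 'D_('D_v f x) g (f x).
Proof.
move=> df dg; rewrite deriveE; last exact: differentiable_comp.
by rewrite diff_comp //= !deriveE.
Qed.

Lemma derive_sum_delta (R : realType) (n : nat) (W : normedModType R)
    (f : 'rV[R]_n -> W) (x v : 'rV[R]_n) : differentiable f x ->
  'D_v f x = \sum_i v 0 i *: 'D_(delta_mx 0 i) f x.
Proof.
move=> df; rewrite deriveE // {1}[v]row_sum_delta linear_sum.
by apply: eq_bigr => i _; rewrite linearZ deriveE.
Qed.

Lemma derive_addf (R : realType) (V W : normedModType R) (f g : V -> W)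
    (x v : V) : differentiable f x -> differentiable g x ->
  'D_v (fun y => f y + g y) x = 'D_v f x + 'D_v g x.
Proof.
move=> df dg; rewrite -deriveD //; exact: diff_derivable.
Qed.

Lemma derive_subf (R : realType) (V W : normedModType R) (f g : V -> W)
    (x v : V) : differentiable f x -> differentiable g x ->
  'D_v (fun y => f y - g y) x = 'D_v f x - 'D_v g x.
Proof.
move=> df dg; rewrite -deriveB //; exact: diff_derivable.
Qed.

(** * Functions of class C^k *)

Lemma Ck_onW (R : realType) (n : nat) (W : normedModType R) (k : nat)
    (U : set 'rV[R]_n) (f : 'rV[R]_n -> W) : Ck_on k.+1 U f -> Ck_on k U f.
Proof.
elim: k f => [|k IH] f /= [df Df].
  by move=> u /df /differentiable_continuous.
by split => // v; apply: IH; exact: Df.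
Qed.

(** Each clause of [Ck_on] speaks of [f] at one point of the set at a time, with derivatives taken
    in the whole space, so one suitable set per point suffices. *)
Lemma Ck_on_local (R : realType) (n : nat) (W : normedModType R) (k : nat)
    (U : set 'rV[R]_n) (f : 'rV[R]_n -> W) :
  (forall u, U u -> exists2 V : set 'rV[R]_n, V u & Ck_on k V f) -> Ck_on k U f.
Proof.
elim: k f => [|k IH] f /= Uf.
  by move=> u /Uf [V Vu]; apply.
split => [u /Uf [V Vu [+ _]]|v]; first exact.
by apply: IH => u /Uf [V Vu [_ Df]]; exists V.
Qed.

Lemma Ck_on_sub (R : realType) (n : nat) (W : normedModType R) (k : nat)
    (U V : set 'rV[R]_n) (f : 'rV[R]_n -> W) :
  V `<=` U -> Ck_on k U f -> Ck_on k V f.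
Proof. by move=> VU Uf; apply: Ck_on_local => u /VU Uu; exists U. Qed.

(** Openness turns equality on [U] into equality near each point, which is what passes to
    derivatives. *)
Lemma Ck_on_eq (R : realType) (n : nat) (W : normedModType R) (k : nat)
    (U : set 'rV[R]_n) (f g : 'rV[R]_n -> W) :
  open U -> (forall u, U u -> f u = g u) -> Ck_on k U f -> Ck_on k U g.
Proof.
move=> oU; elim: k f g => [|k IH] f g /= fg.
  have nfg u : U u -> \forall v \near u, f v = g v.
    by move=> Uu; apply: filterS (open_nbhs_nbhs (conj oU Uu)) => v /fg.
  move=> fc u Uu; apply: cvg_trans (near_eq_cvg (nfg u Uu)) _.
  by rewrite -(fg u Uu); exact: fc.
have nfg u : U u -> \forall v \near u, f v = g v.
  by move=> Uu; apply: filterS (open_nbhs_nbhs (conj oU Uu)) => v /fg.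
move=> [df Df]; split => [u Uu|v].
  by apply: differentiable_near_eq (df u Uu); exact: nfg.
apply: IH (Df v) => u Uu.
exact: near_eq_derive (nfg u Uu).
Qed.

Lemma Ck_on_cst (R : realType) (n : nat) (W : normedModType R) (k : nat)
    (U : set 'rV[R]_n) (c : W) : Ck_on k U (fun=> c).
Proof.
elim: k c => [|k IH] c /=; first by move=> u _; exact: cst_continuous.
split => [u _|v]; first exact: differentiable_cst.
have -> : (fun u => 'D_v (fun=> c) u) = (fun=> 0 : W) by apply/funext => u; exact: derive_cst.
exact: IH.
Qed.

Lemma Ck_onD (R : realType) (n : nat) (W : normedModType R) (k : nat)
    (U : set 'rV[R]_n) (f g : 'rV[R]_n -> W) : open U ->
  Ck_on k U f -> Ck_on k U g -> Ck_on k U (fun u => f u + g u).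
Proof.
move=> oU; elim: k f g => [|k IH] f g /=.
  by move=> fc gc u Uu; apply: continuousD; [exact: fc|exact: gc].
move=> [df Df] [dg Dg]; split => [u Uu|v].
  by apply: differentiableD; [exact: df|exact: dg].
apply: Ck_on_eq (IH _ _ (Df v) (Dg v)) => // u Uu.
by rewrite deriveD //; apply: diff_derivable; [exact: df|exact: dg].
Qed.

Lemma Ck_on_sum (R : realType) (n : nat) (W : normedModType R) (k : nat)
    (U : set 'rV[R]_n) (I : Type) (r : seq I) (f : I -> 'rV[R]_n -> W) :
  open U -> (forall i, Ck_on k U (f i)) ->
  Ck_on k U (fun u => \sum_(i <- r) f i u).
Proof.
move=> oU fC; elim: r => [|i r IH].
  by apply: Ck_on_eq (Ck_on_cst _ _ 0) => // u _; rewrite big_nil.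
by apply: Ck_on_eq (Ck_onD oU (fC i) IH) => // u _; rewrite big_cons.
Qed.

Lemma Ck_on_linear (R : realType) (n : nat) (W W' : normedModType R) (k : nat)
    (U : set 'rV[R]_n) (L : {linear W -> W'}) (f : 'rV[R]_n -> W) :
  open U -> continuous L -> Ck_on k U f -> Ck_on k U (fun u => L (f u)).
Proof.
move=> oU Lc; elim: k f => [|k IH] f /=.
  by move=> fc u Uu; apply: (@continuous_comp _ _ _ f L); [exact: fc|exact: Lc].
move=> [df Df]; split => [u Uu|v].
  by apply: differentiable_linear_comp => //; exact: df.
apply: Ck_on_eq (IH _ (Df v)) => // u Uu.
by rewrite derive_linear_comp //; exact: df.
Qed.

(** The derivative is a sum of two products, each of one derivative and one undifferentiated factor;
    [Ck_onW] lowers the class of the latter so that the induction applies. *)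
Lemma Ck_on_bilin (R : realType) (n : nat) (W1 W2 W : normedModType R) (k : nat)
    (U : set 'rV[R]_n) (b : {bilinear W1 -> W2 -> W})
    (f : 'rV[R]_n -> W1) (g : 'rV[R]_n -> W2) :
  open U -> continuous (fun p => b p.1 p.2) ->
  Ck_on k U f -> Ck_on k U g -> Ck_on k U (fun u => b (f u) (g u)).
Proof.
move=> oU bc; elim: k f g => [|k IH] f g.
  move=> /= fc gc u Uu.
  apply: (@continuous_comp _ _ _ (fun u => (f u, g u)) (fun p => b p.1 p.2)).
    by apply: (cvg_pair (F := nbhs u)); [apply: fc|apply: gc].
  exact: bc.
move=> fC gC; have [df Df] := fC; have [dg Dg] := gC; split => [u Uu|v].
  by have [] := diff_bilin_comp bc (df u Uu) (dg u Uu).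
apply: (Ck_on_eq oU _ (Ck_onD oU (IH _ _ (Df v) (Ck_onW gC)) (IH _ _ (Ck_onW fC) (Dg v)))).
by move=> u Uu; have [_ ->] := diff_bilin_comp bc (df u Uu) (dg u Uu).
Qed.

(** A named function with values in [R^o], so that it can carry a linear structure and be used as a
    map between normed modules. *)
Definition mx_entry (R : realType) (m n : nat) (i : 'I_m) (j : 'I_n)
  (A : 'M[R]_(m, n)) : R^o := A i j.

Lemma mx_entry_linear (R : realType) (m n : nat) (i : 'I_m) (j : 'I_n) :
  linear (@mx_entry R m n i j).
Proof. by move=> c A B; rewrite /mx_entry !mxE. Qed.

HB.instance Definition _ (R : realType) (m n : nat) (i : 'I_m) (j : 'I_n) :=
  GRing.isLinear.Build R 'M[R]_(m, n) R^o _ (@mx_entry R m n i j)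
    (@mx_entry_linear R m n i j).

(** In the chain rule [g] is differentiated along ['D_v f u], which varies with [u], while [Ck_on]
    only knows fixed directions. Expanding that direction in the basis gives a sum of scalar
    functions times compositions of [f] with derivatives of [g], to which the induction hypothesis
    applies. *)
Lemma Ck_on_comp (R : realType) (m n : nat) (W : normedModType R) (k : nat)
    (U : set 'rV[R]_m) (V : set 'rV[R]_n) (f : 'rV[R]_m -> 'rV[R]_n)
    (g : 'rV[R]_n -> W) : open U -> (forall u, U u -> V (f u)) ->
  Ck_on k U f -> Ck_on k V g -> Ck_on k U (g \o f).
Proof.
move=> oU UV; elim: k f g UV => [|k IH] f g UV.
  move=> /= fc gc u Uu; apply: continuous_comp; first exact: fc.
  by apply: gc; exact: UV.
move=> fC gC; have [df Df] := fC; have [dg Dg] := gC; split => [u Uu|v].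
  by apply: differentiable_comp; [exact: df|exact/dg/UV].
have termC (i : 'I_n) :
    Ck_on k U (fun u => mx_entry 0 i ('D_v f u) *: 'D_(delta_mx 0 i) g (f u)).
  apply: (@Ck_on_bilin _ _ R^o W W _ _ *:%R) => //; first exact: scale_continuous.
    by apply: Ck_on_linear (Df v) => // x; exact: linear_mx_continuous.
  exact: (IH _ _ UV (Ck_onW fC) (Dg _)).
apply: (Ck_on_eq oU _ (Ck_on_sum (index_enum 'I_n) oU termC)) => u Uu.
have dgu := dg _ (UV u Uu).
by rewrite (derive_comp v (df u Uu) dgu) (derive_sum_delta _ dgu).
Qed.

(** * Smooth functions on subsets of R^n *)

Lemma smooth_on_local (R : realType) (n : nat) (W : normedModType R)
    (U : set 'rV[R]_n) (f : 'rV[R]_n -> W) :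
  (forall u, U u -> exists2 V : set 'rV[R]_n, V u & smooth_on V f) ->
  smooth_on U f.
Proof. by move=> Uf k; apply: Ck_on_local => u /Uf [V Vu /(_ k)]; exists V. Qed.

Lemma smooth_on_sub (R : realType) (n : nat) (W : normedModType R)
    (U V : set 'rV[R]_n) (f : 'rV[R]_n -> W) :
  V `<=` U -> smooth_on U f -> smooth_on V f.
Proof. by move=> VU Uf k; exact: Ck_on_sub (Uf k). Qed.

Lemma smooth_on_eq (R : realType) (n : nat) (W : normedModType R)
    (U : set 'rV[R]_n) (f g : 'rV[R]_n -> W) :
  open U -> (forall u, U u -> f u = g u) -> smooth_on U f -> smooth_on U g.
Proof. by move=> oU fg Uf k; exact: Ck_on_eq (Uf k). Qed.

Lemma smooth_on_cst (R : realType) (n : nat) (W : normedModType R)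
    (U : set 'rV[R]_n) (c : W) : smooth_on U (fun=> c).
Proof. by move=> k; exact: Ck_on_cst. Qed.

Lemma smooth_onD (R : realType) (n : nat) (W : normedModType R)
    (U : set 'rV[R]_n) (f g : 'rV[R]_n -> W) : open U ->
  smooth_on U f -> smooth_on U g -> smooth_on U (fun u => f u + g u).
Proof. by move=> oU Uf Ug k; exact: Ck_onD. Qed.

Lemma smooth_on_sum (R : realType) (n : nat) (W : normedModType R)
    (U : set 'rV[R]_n) (I : Type) (r : seq I) (f : I -> 'rV[R]_n -> W) :
  open U -> (forall i, smooth_on U (f i)) ->
  smooth_on U (fun u => \sum_(i <- r) f i u).
Proof. by move=> oU Uf k; apply: Ck_on_sum => // i; exact: Uf. Qed.

Lemma smooth_on_linear_mx (R : realType) (n p q : nat) (W : normedModType R)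
    (U : set 'rV[R]_n) (L : {linear 'M[R]_(p, q) -> W})
    (f : 'rV[R]_n -> 'M[R]_(p, q)) :
  open U -> smooth_on U f -> smooth_on U (fun u => L (f u)).
Proof.
by move=> oU Uf k; apply: Ck_on_linear (Uf k) => //; exact: linear_mx_continuous.
Qed.

Lemma smooth_on_mulmx (R : realType) (n m p q : nat) (U : set 'rV[R]_n)
    (f : 'rV[R]_n -> 'M[R]_(m, p)) (g : 'rV[R]_n -> 'M[R]_(p, q)) :
  open U -> smooth_on U f -> smooth_on U g -> smooth_on U (fun u => f u *m g u).
Proof.
move=> oU Uf Ug k; apply: (@Ck_on_bilin _ _ _ _ _ _ _ mulmx) => //.
exact: mulmx_continuous.
Qed.

Lemma smooth_on_comp (R : realType) (m n : nat) (W : normedModType R)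
    (U : set 'rV[R]_m) (V : set 'rV[R]_n) (f : 'rV[R]_m -> 'rV[R]_n)
    (g : 'rV[R]_n -> W) : open U -> (forall u, U u -> V (f u)) ->
  smooth_on U f -> smooth_on V g -> smooth_on U (g \o f).
Proof. by move=> oU UV Uf Vg k; exact: Ck_on_comp UV (Uf k) (Vg k). Qed.

Lemma smooth_on_differentiable (R : realType) (n : nat) (W : normedModType R)
    (U : set 'rV[R]_n) (f : 'rV[R]_n -> W) (u : 'rV[R]_n) :
  smooth_on U f -> U u -> differentiable f u.
Proof. by move=> /(_ 1%N) [df _] /df. Qed.

Lemma smooth_on_derive (R : realType) (n : nat) (W : normedModType R)
    (U : set 'rV[R]_n) (f : 'rV[R]_n -> W) (v : 'rV[R]_n) :
  smooth_on U f -> smooth_on U (fun u => 'D_v f u).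
Proof. by move=> Uf k; have [_] := Uf k.+1; apply. Qed.

(** The Jacobian is assembled from its rows, the derivatives of [f] along the basis vectors. *)
Lemma smooth_on_jacobian (R : realType) (m n : nat)
    (U : set 'rV[R]_m) (f : 'rV[R]_m -> 'rV[R]_n) :
  open U -> smooth_on U f -> smooth_on U (fun u => 'J f u).
Proof.
move=> oU Uf.
have termS (i : 'I_m) :
    smooth_on U (fun u => (delta_mx i 0 : 'cV[R]_m) *m 'D_(delta_mx 0 i) f u).
  by apply: smooth_on_linear_mx => //; exact: smooth_on_derive.
apply: (smooth_on_eq oU _ (smooth_on_sum (index_enum 'I_m) oU termS)) => u Uu.
have df := smooth_on_differentiable Uf Uu.
apply/row_matrixP => i; rewrite !rowE -deriveEjacobian // mulmx_sumr.
rewrite (bigD1 i) //= mulmxA mul_delta_mx big1 ?addr0 => [|j ji].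
  by apply/rowP => j; rewrite !mxE big_ord_recl big_ord0 addr0 mxE !eqxx mul1r.
by rewrite mulmxA mul_delta_mx_0 ?mul0mx // eq_sym.
Qed.

(** * Symmetry of second derivatives *)

(** The mean value theorem for s |-> f(s v + a + w) - f(s v + a): a second difference of [f] becomes
    a first difference of ['D_v f]. *)
Lemma MVT_line (R : realType) (V : normedModType R) (f : V -> R^o) (a v w : V)
    (h : R) : 0 < h ->
  (forall s, 0 <= s <= h -> differentiable f (s *: v + a + w)) ->
  (forall s, 0 <= s <= h -> differentiable f (s *: v + a)) ->
  exists2 c, 0 <= c <= h &
    (f (h *: v + a + w) - f (h *: v + a)) - (f (a + w) - f a)
    = h * ('D_v f (c *: v + a + w) - 'D_v f (c *: v + a)).
Proof.
move=> h0 dw d0.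
pose phi (s : R) : R := f (s *: v + a + w) - f (s *: v + a).
pose dphi (s : R) : R := 'D_v f (s *: v + a + w) - 'D_v f (s *: v + a).
have dline (b : V) (s : R) : is_diff s (fun s : R => s *: v + b) ( *:%R^~ v).
  have -> : (fun s : R => s *: v + b) = *:%R^~ v + cst b by [].
  apply: is_diff_eq.
  by apply/funext => t; rewrite !fctE addr0.
have dphiE s : 0 <= s <= h -> differentiable phi s /\ 'D_1 phi s = dphi s.
  move=> sh.
  have dl b := @ex_diff _ _ _ _ _ _ _ (dline b s).
  have d1 : differentiable (f \o (fun s : R => s *: v + (a + w))) s.
    by apply: differentiable_comp => //; rewrite addrA; exact: dw.
  have d2 : differentiable (f \o (fun s : R => s *: v + a)) s.
    by apply: differentiable_comp => //; exact: d0.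
  have E : phi = (f \o (fun s : R => s *: v + (a + w))) - (f \o (fun s : R => s *: v + a)).
    by apply/funext => t; rewrite /phi !fctE /= addrA.
  rewrite E; split; first exact: differentiableB.
  have dE b : 'D_1 (fun s : R => s *: v + b) s = v.
    by rewrite deriveE // diff_val scale1r.
  rewrite deriveB; [|exact: diff_derivable|exact: diff_derivable].
  have D b : differentiable f (s *: v + b) ->
      'D_1 (f \o (fun s : R => s *: v + b)) s = 'D_v f (s *: v + b).
    by move=> df; rewrite -[X in _ = 'D_X f _](dE b); exact: derive_comp (dl b) df.
  rewrite (D (a + w)) ?(D a) ?addrA //; first exact: d0.
  exact: dw.
have [||c ch E] := @MVT_segment R phi dphi 0 h (ltW h0).
- move=> s /[!in_itv] /= /andP[s0 sh].
  have [|ds Ds] := dphiE s; first by rewrite !ltW.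
  by split => //; exact: diff_derivable.
- apply: continuous_in_subspaceT => s /[!inE] /= /[!in_itv] /= sh.
  by have [ds _] := dphiE s sh; exact: differentiable_continuous.
exists c; first by move: ch; rewrite in_itv.
by move: E; rewrite /phi /dphi subr0 scale0r add0r mulrC.
Qed.

(** [MVT_line] with [h *: w] as second increment leaves two values of ['D_v f] near [a]. In their
    first-order expansions at [a] the terms linear in the unknown intermediate point c v cancel, and
    h times the derivative along [w] remains. *)
Lemma second_difference (R : realType) (V : normedModType R) (f : V -> R^o)
    (a v w : V) (e : R) : 0 < e ->
  (\forall x \near a, differentiable f x) ->
  differentiable (fun x => 'D_v f x) a ->
  \forall h \near 0^'+, `|f (h *: v + h *: w + a) - f (h *: v + a)
      - f (h *: w + a) + f a - h ^+ 2 * 'D_w (fun x => 'D_v f x) a| <= e * h ^+ 2.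
Proof.
move=> e0 df dg; set g := fun x => 'D_v f x.
(* The two expansion errors are proportional to the norms of c v + h w and c v, together at most h
   (2 |v| + |w|); the summand 1 makes [N] positive. *)
pose N := 2 * `|v| + `|w| + 1.
have N0 : 0 < N by rewrite /N ltr_pwDr // addr_ge0 // mulr_ge0.
have eN0 : 0 < e / N by rewrite divr_gt0.
have [r r0 rP] : exists2 r : R, 0 < r & forall k : V, `|k| < r ->
    differentiable f (k + a) /\ `|g (k + a) - g a - 'd g a k| <= e / N * `|k|.
  have Dg : \forall k \near (0 : V), `|g (k + a) - g a - 'd g a k| <= e / N * `|k|.
    have /eqaddoP/(_ _ eN0) := diff_locally dg.
    by apply: filterS => k; rewrite !fctE /= opprD addrA.
  have df0 : \forall k \near (0 : V), differentiable f (k + a).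
    move: df; rewrite (near_shift 0) /=; apply: filterS => k.
    by rewrite subr0.
  have /nbhs_ballP[r /= r0 rP] : nbhs (0 : V) [set k | differentiable f (k + a) /\
      `|g (k + a) - g a - 'd g a k| <= e / N * `|k|] by exact: filterI.
  exists r => // k kr; apply: rP.
  by rewrite -ball_normE /= sub0r normrN.
near=> h.
have h0 : 0 < h by [].
have hr : h * N < r.
  rewrite -ltr_pdivlMr //; near: h; apply: nbhs_right_lt; exact: divr_gt0.
have nk s t : 0 <= s <= h -> 0 <= t <= h -> `|s *: v + t *: w| <= h * (`|v| + `|w|).
  move=> /andP[s0 sh] /andP[t0 th]; rewrite (le_trans (ler_normD _ _)) // mulrDr.
  by rewrite !normrZ !ger0_norm // lerD // ler_wpM2r.
have small s t : 0 <= s <= h -> 0 <= t <= h -> `|s *: v + t *: w| < r.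
  move=> sh th; apply: le_lt_trans (nk _ _ sh th) _; apply: le_lt_trans hr.
  apply: ler_wpM2l; first exact: ltW.
  rewrite /N; have := normr_ge0 v; lra.
have hh : 0 <= h <= h by rewrite lexx ltW.
have h00 : (0 : R) <= 0 <= h by rewrite lexx ltW.
have [s sh|s sh|c ch E] := @MVT_line R V f a v (h *: w) h h0.
- have [] := rP _ (small _ _ sh hh); by rewrite addrAC.
- have [] := rP _ (small _ _ sh h00); by rewrite scale0r addr0.
have [_] := rP _ (small _ _ ch hh); have [_] := rP _ (small _ _ ch h00).
rewrite scale0r addr0 => e1 e2.
have -> : f (h *: v + h *: w + a) - f (h *: v + a) - f (h *: w + a) + f a =
    h * (g (c *: v + h *: w + a) - g (c *: v + a)).
  rewrite [c *: v + _ + a]addrAC [h *: v + _ + a]addrAC -E [h *: w + a]addrC.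
  by rewrite opprD opprK !addrA.
rewrite (deriveE _ dg).
set A := g (c *: v + h *: w + a) in e2 *; set B := g (c *: v + a) in e1 *.
have dE : 'd g a (c *: v + h *: w) = 'd g a (c *: v) + h * 'd g a w.
  by rewrite linearD; congr (_ + _); rewrite linearZ.
rewrite dE in e2; set D := 'd g a (c *: v) in e1 e2; set Dw := 'd g a w in e2 *.
have -> : h * (A - B) - h ^+ 2 * Dw =
    h * ((A - g a - (D + h * Dw)) - (B - g a - D)) by ring.
rewrite normrM gtr0_norm // expr2 [e * _]mulrCA ler_pM2l //.
apply: le_trans (ler_normB _ _) _.
apply: le_trans (lerD e2 e1) _.
rewrite -mulrDr mulrAC ler_pdivrMr // -mulrA ler_pM2l //.
apply: le_trans (lerD (nk _ _ ch hh) (_ : _ <= h * `|v|)) _.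
  by move: ch => /andP[c0 ch]; rewrite normrZ ger0_norm // ler_wpM2r.
rewrite -mulrDr; apply: ler_wpM2l; first exact: ltW.
by rewrite /N; have := normr_ge0 v; lra.
Unshelve. all: by end_near. Qed.

(** The second difference is symmetric in [v] and [w], and after division by h^2 it approximates
    both mixed derivatives, each within [e / 2]. *)
Lemma derive_sym (R : realType) (V : normedModType R) (f : V -> R^o) (a v w : V) :
  (\forall x \near a, differentiable f x) ->
  differentiable (fun x => 'D_v f x) a -> differentiable (fun x => 'D_w f x) a ->
  'D_w (fun x => 'D_v f x) a = 'D_v (fun x => 'D_w f x) a.
Proof.
move=> df dv dw; set D1 := LHS; set D2 := RHS.
apply/eqP; rewrite -subr_eq0 -normr_le0; apply/ler_addgt0Pr => e e0; rewrite add0r.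
have e2 : 0 < e / 2 by rewrite divr_gt0.
have [h [h0 [H1 H2]]] : exists h : R, 0 < h /\
    (`|f (h *: v + h *: w + a) - f (h *: v + a)
      - f (h *: w + a) + f a - h ^+ 2 * D1| <= e / 2 * h ^+ 2 /\
    `|f (h *: w + h *: v + a) - f (h *: w + a)
      - f (h *: v + a) + f a - h ^+ 2 * D2| <= e / 2 * h ^+ 2).
  apply: (@filter_ex _ (0 : R)^'+).
  apply: filterI; first exact: nbhs_right_gt.
  by apply: filterI; exact: second_difference.
have hh : 0 < h ^+ 2 by rewrite exprn_gt0.
rewrite -(ler_pM2r hh) -[X in _ * X <= _](gtr0_norm hh) -normrM.
move: H1 H2; rewrite [h *: w + h *: v]addrC.
set F := f (_ + _ + a); set F1 := f (h *: v + a); set F2 := f (h *: w + a) => H1 H2.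
have -> : (D1 - D2) * h ^+ 2 = (F - F2 - F1 + f a - h ^+ 2 * D2)
    - (F - F1 - F2 + f a - h ^+ 2 * D1).
  by ring.
apply: le_trans (ler_normB _ _) _; apply: le_trans (lerD H2 H1) _.
by rewrite -mulrDl -splitr.
Qed.

(** The mean value theorem is scalar, so symmetry is obtained entry by entry; taking an entry
    commutes with derivatives near [u]. *)
Lemma derive_mx_sym (R : realType) (n p q : nat) (U : set 'rV[R]_n)
    (f : 'rV[R]_n -> 'M[R]_(p, q)) (u v w : 'rV[R]_n) :
  open U -> U u -> smooth_on U f ->
  'D_w (fun x => 'D_v f x) u = 'D_v (fun x => 'D_w f x) u.
Proof.
move=> oU Uu Uf; apply/matrixP => i j.
have entryc : continuous (@mx_entry R p q i j).
  by move=> x; exact: linear_mx_continuous.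
have nU : \forall x \near u, U x by exact: open_nbhs_nbhs.
have df x : U x -> differentiable f x by exact: smooth_on_differentiable.
have dDf z x : U x -> differentiable (fun x => 'D_z f x) x.
  by move=> Ux; apply: smooth_on_differentiable (smooth_on_derive z Uf) Ux.
have DE z : {near u, (fun x => mx_entry i j ('D_z f x))
    =1 (fun x => 'D_z (fun y => mx_entry i j (f y)) x)}.
  by apply: filterS nU => x Ux; rewrite derive_linear_comp //; exact: df.
have dE z : differentiable (fun x => 'D_z (fun y => mx_entry i j (f y)) x) u.
  apply: differentiable_near_eq (DE z) _.
  by apply: differentiable_linear_comp => //; exact: dDf.
have E z z' : mx_entry i j ('D_z' (fun x => 'D_z f x) u)
    = 'D_z' (fun x => 'D_z (fun y => mx_entry i j (f y)) x) u.
  rewrite -derive_linear_comp //; last exact: dDf.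
  by apply: near_eq_derive; exact: DE.
apply: (etrans (E v w)); apply/esym; apply: (etrans (E w v)).
apply: derive_sym => //.
by apply: filterS nU => x Ux; apply: differentiable_linear_comp => //; exact: df.
Qed.

(** * Smooth manifolds *)

Lemma mulmx_rV_inj (R : realType) (m n : nat) (A B : 'M[R]_(m, n)) :
  (forall v : 'rV[R]_m, v *m A = v *m B) -> A = B.
Proof. by move=> AB; apply/row_matrixP => i; rewrite !rowE. Qed.

(** The device that carries statements about points of the manifold to statements near a point of
    R^n: [chart_map i] undoes [chartV i] only on the image of the chart, which is open. *)
Lemma near_chart (R : realType) (n : nat) (M : manifold R n) (i : chart M)
    (U : set M) (x : M) : open U -> U x -> dom i x ->
  \forall u \near chart_map i x,
    [/\ U (chartV i u), dom i (chartV i u) & chart_map i (chartV i u) = u].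
Proof.
move=> oU Ux ix.
have ci : (chart_map i @` dom i) (chart_map i x) by exists x.
have near_codom := open_nbhs_nbhs (conj (@open_codom _ _ M i) ci).
have nU : nbhs (chartV i (chart_map i x)) U.
  by rewrite chart_mapK //; exact: open_nbhs_nbhs.
have near_U := chartV_continuous ci nU.
apply: filterS2 near_codom near_U => _ [y iy <-] /=.
by rewrite !chart_mapK.
Qed.

Lemma open_chart_image (R : realType) (n : nat) (M : manifold R n)
    (i : chart M) (U : set M) : open U -> open (chart_map i @` (U `&` dom i)).
Proof.
move=> oU; rewrite openE => _ [x [Ux ix] <-].
apply: filterS (near_chart oU Ux ix) => u [Uu iu <-].
by exists (chartV i u); rewrite // iu.
Qed.

Lemma open_chart_overlap (R : realType) (n : nat) (M : manifold R n)
    (i j : chart M) : open (chart_map i @` (dom i `&` dom j)).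
Proof. by rewrite setIC; apply: open_chart_image; exact: open_dom. Qed.

Lemma chart_change_differentiable (R : realType) (n : nat) (M : manifold R n)
    (i j : chart M) (x : M) : dom i x -> dom j x ->
  differentiable (chart_map j \o chartV i) (chart_map i x).
Proof.
move=> ix jx; apply: smooth_on_differentiable (@chart_change_smooth _ _ M i j) _.
by exists x.
Qed.

Lemma mul_jac (R : realType) (n : nat) (M : manifold R n) (i j : chart M)
    (x : M) (v : 'rV[R]_n) : dom i x -> dom j x ->
  v *m jac i j x = 'D_v (chart_map j \o chartV i) (chart_map i x).
Proof.
by move=> ix jx; rewrite deriveEjacobian //; exact: chart_change_differentiable.
Qed.

Lemma jacE (R : realType) (n : nat) (M : manifold R n) (i j : chart M) :
  jac i j = (fun u => 'J (chart_map j \o chartV i) u) \o chart_map i.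
Proof. by []. Qed.

Lemma jac_id (R : realType) (n : nat) (M : manifold R n) (i : chart M) (x : M) :
  dom i x -> jac i i x = 1%:M.
Proof.
move=> ix; apply: mulmx_rV_inj => v.
rewrite mul_jac // mulmx1 -[RHS](derive_id (chart_map i x)).
apply: near_eq_derive.
by apply: filterS (near_chart openT I ix) => u [].
Qed.

(** The cocycle identity is the chain rule for transition maps; the composite of two of them agrees
    with the third only near the point. *)
Lemma jac_mul (R : realType) (n : nat) (M : manifold R n) (i j k : chart M)
    (x : M) : dom i x -> dom j x -> dom k x ->
  jac i j x *m jac j k x = jac i k x.
Proof.
move=> ix jx kx.
have dij := chart_change_differentiable ix jx.
have E : (chart_map j \o chartV i) (chart_map i x) = chart_map j x.
  by rewrite /= chart_mapK.
have djk : differentiable (chart_map k \o chartV j)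
    ((chart_map j \o chartV i) (chart_map i x)).
  by rewrite E; exact: chart_change_differentiable.
have chain v : 'D_('D_v (chart_map j \o chartV i) (chart_map i x))
      (chart_map k \o chartV j) (chart_map j x)
    = 'D_v (chart_map k \o chartV i) (chart_map i x).
  rewrite -E -(derive_comp v dij djk); apply: near_eq_derive.
  apply: filterS (near_chart (@open_dom _ _ _ j) jx ix) => u [ju iu _] /=.
  by rewrite chart_mapK.
move: (fun v => mul_jac v ix jx) (fun v => mul_jac v jx kx)
  (fun v => mul_jac v ix kx).
(* Comparing distinct Jacobians by conversion would unfold their differentials. *)
move: (jac i j x) (jac j k x) (jac i k x) => Jij Jjk Jik ijE jkE ikE.
by apply: mulmx_rV_inj => v; rewrite mulmxA ijE jkE ikE chain.
Qed.

Lemma jacK (R : realType) (n : nat) (M : manifold R n) (i j : chart M) (x : M) :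
  dom i x -> dom j x -> jac i j x *m jac j i x = 1%:M.
Proof. by move=> ix jx; rewrite jac_mul // jac_id. Qed.

(** One chart containing [U] is enough, since any other chart is reached through a smooth transition
    map. *)
Lemma msmooth_on_chart (R : realType) (n : nat) (M : manifold R n)
    (W : normedModType R) (U : set M) (i : chart M) (f : M -> W) :
  open U -> U `<=` dom i -> smooth_on (chart_map i @` U) (f \o chartV i) ->
  msmooth_on U f.
Proof.
move=> oU Ui Uf l; have oUl := open_chart_image (i := l) oU.
have chg : smooth_on (chart_map l @` (U `&` dom l)) (chart_map i \o chartV l).
  apply: smooth_on_sub (@chart_change_smooth _ _ M l i).
  by apply: image_subset => x [/Ui ix lx].
apply: smooth_on_eq (smooth_on_comp oUl _ chg Uf) => //.
  by move=> _ [x [Ux lx] <-] /=; rewrite chart_mapK // chart_mapK //; exact: Ui.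
by move=> _ [x [Ux lx] <-] /=; exists x => //; rewrite chart_mapK.
Qed.

Lemma msmooth_on_sub (R : realType) (n : nat) (M : manifold R n)
    (W : normedModType R) (U V : set M) (f : M -> W) :
  V `<=` U -> msmooth_on U f -> msmooth_on V f.
Proof.
move=> VU Uf i; apply: smooth_on_sub (Uf i).
by apply: image_subset => x [/VU Ux ix].
Qed.

Lemma msmooth_on_eq (R : realType) (n : nat) (M : manifold R n)
    (W : normedModType R) (U : set M) (f g : M -> W) :
  open U -> (forall x, U x -> f x = g x) -> msmooth_on U f -> msmooth_on U g.
Proof.
move=> oU fg Uf i; apply: smooth_on_eq (Uf i); first exact: open_chart_image.
by move=> _ [x [Ux ix] <-] /=; rewrite chart_mapK // fg.
Qed.

Lemma msmooth_on_local (R : realType) (n : nat) (M : manifold R n)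
    (W : normedModType R) (U : set M) (f : M -> W) :
  (forall x, U x -> exists2 V : set M, V x & msmooth_on V f) -> msmooth_on U f.
Proof.
move=> Uf i; apply: smooth_on_local => _ [x [Ux ix] <-].
have [V Vx Vf] := Uf x Ux.
by exists (chart_map i @` (V `&` dom i)) => //; exists x.
Qed.

Lemma msmooth_onD (R : realType) (n : nat) (M : manifold R n)
    (W : normedModType R) (U : set M) (f g : M -> W) : open U ->
  msmooth_on U f -> msmooth_on U g -> msmooth_on U (fun x => f x + g x).
Proof.
move=> oU Uf Ug i; apply: (smooth_onD _ (Uf i) (Ug i)).
exact: open_chart_image.
Qed.

Lemma msmooth_on_linear_mx (R : realType) (n p q : nat) (M : manifold R n)
    (W : normedModType R) (U : set M) (L : {linear 'M[R]_(p, q) -> W})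
    (f : M -> 'M[R]_(p, q)) :
  open U -> msmooth_on U f -> msmooth_on U (fun x => L (f x)).
Proof.
move=> oU Uf i; apply: (smooth_on_linear_mx _ _ (Uf i)).
exact: open_chart_image.
Qed.

Lemma msmooth_on_mulmx (R : realType) (n m p q : nat) (M : manifold R n)
    (U : set M) (f : M -> 'M[R]_(m, p)) (g : M -> 'M[R]_(p, q)) : open U ->
  msmooth_on U f -> msmooth_on U g -> msmooth_on U (fun x => f x *m g x).
Proof.
move=> oU Uf Ug i; apply: (smooth_on_mulmx _ (Uf i) (Ug i)).
exact: open_chart_image.
Qed.

Lemma msmooth_on_trmx (R : realType) (n p q : nat) (M : manifold R n)
    (U : set M) (f : M -> 'M[R]_(p, q)) : open U ->
  msmooth_on U f -> msmooth_on U (fun x => (f x)^T).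
Proof. by move=> oU Uf; exact: msmooth_on_linear_mx. Qed.

Lemma msmooth_jac (R : realType) (n : nat) (M : manifold R n) (i j : chart M) :
  msmooth_on (dom i `&` dom j) (jac i j).
Proof.
move=> l.
have oij : open (dom i `&` dom j) by apply: openI; exact: open_dom.
rewrite jacE; have smJ := smooth_on_jacobian (@open_chart_overlap _ _ M i j)
  (@chart_change_smooth _ _ M i j).
have chg : smooth_on (chart_map l @` ((dom i `&` dom j) `&` dom l))
    (chart_map i \o chartV l).
  apply: smooth_on_sub (@chart_change_smooth _ _ M l i).
  by apply: image_subset => x [[ix jx] lx].
apply: (smooth_on_comp (open_chart_image (i := l) oij) _ chg smJ).
by move=> _ [x [[ix jx] lx] <-] /=; exists x => //; rewrite chart_mapK.
Qed.

(** * Components in charts, and the tangent and cotangent bundles *)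

Lemma vcomp_change (R : realType) (n : nat) (M : manifold R n) (i j : chart M)
    (X : M -> 'rV[R]_n) (x : M) : dom i x -> dom j x ->
  vcomp j X x = vcomp i X x *m jac i j x.
Proof.
by move=> ix jx; rewrite /vcomp -mulmxA jac_mul //; exact: dom_chart_at.
Qed.

Lemma vcomp_at (R : realType) (n : nat) (M : manifold R n)
    (X : M -> 'rV[R]_n) (x : M) : vcomp (chart_at x) X x = X x.
Proof. by rewrite /vcomp jac_id ?mulmx1 //; exact: dom_chart_at. Qed.

Lemma fcomp_at (R : realType) (n : nat) (M : manifold R n)
    (a : M -> 'cV[R]_n) (x : M) : fcomp (chart_at x) a x = a x.
Proof. by rewrite /fcomp jac_id ?mul1mx //; exact: dom_chart_at. Qed.

Lemma f2comp_at (R : realType) (n : nat) (M : manifold R n)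
    (w : M -> 'M[R]_n) (x : M) : f2comp (chart_at x) w x = w x.
Proof.
by rewrite /f2comp jac_id ?trmx1 ?mulmx1 ?mul1mx //; exact: dom_chart_at.
Qed.

Lemma is_vbundle_tangent (R : realType) (n : nat) (M : manifold R n) :
  is_vbundle (tangent M).
Proof.
split => /=.
- exact: open_dom.
- by move=> x; exists (chart_at x); exact: dom_chart_at.
- move=> i x ix; split=> [c u v|]; first by rewrite mulmxDl scalemxAl.
  have cx := @dom_chart_at _ _ M x.
  exists (fun v => v *m jac i (chart_at x) x) => v.
    by rewrite -mulmxA jacK ?mulmx1.
  by rewrite -mulmxA jacK ?mulmx1.
- move=> i j; exists (jac i j); first exact: msmooth_jac.
  by move=> x e ix jx; rewrite -mulmxA jac_mul //; exact: dom_chart_at.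
Qed.

Lemma is_vbundle_cotangent (R : realType) (n : nat) (M : manifold R n) :
  is_vbundle (cotangent M).
Proof.
split => /=.
- exact: open_dom.
- by move=> x; exists (chart_at x); exact: dom_chart_at.
- move=> i x ix; split=> [c u v|]; first by rewrite mulmxDr -scalemxAr linearP.
  have cx := @dom_chart_at _ _ M x.
  exists (fun v => jac (chart_at x) i x *m v^T) => v.
    by rewrite trmxK mulmxA jacK ?mul1mx.
  by rewrite mulmxA jacK ?mul1mx ?trmxK.
(* Covector components transform by the inverse Jacobian; it is transposed because the
   trivializations take values in row vectors. *)
- move=> i j; exists (fun x => (jac j i x)^T).
    rewrite setIC; apply: msmooth_on_trmx; last exact: msmooth_jac.
    by apply: openI; exact: open_dom.
  move=> x e ix jx.
  have <- := jac_mul jx ix (@dom_chart_at _ _ M x).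
  by rewrite -[in LHS]mulmxA trmx_mul.
Qed.

Lemma vb_morphism_section (R : realType) (n : nat) (M : manifold R n)
    (E F : vbundle M) (f : forall x, E x -> F x) (s : msection E) :
  is_vbundle E -> is_vbundle F -> vb_morphism f -> smooth_section s ->
  smooth_section (fun x => f x (s x)).
Proof.
move=> [oE covE _ _] [oF _ _ _] [_ fsm] ss t; apply: msmooth_on_local => x tx.
have [r rx] := covE x; have [g gs fE] := fsm r t.
have o : open (tdom r `&` tdom t) by apply: openI; [exact: oE|exact: oF].
exists (tdom r `&` tdom t) => //.
apply: (msmooth_on_eq o _ (msmooth_on_mulmx o (msmooth_on_sub _ (ss r)) gs)).
  by move=> y [ry ty]; rewrite fE.
by move=> y [].
Qed.

(** * The Lie bracket in coordinates *)

Lemma mul_derive_jacobian (R : realType) (m n : nat) (U : set 'rV[R]_m)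
    (F : 'rV[R]_m -> 'rV[R]_n) (u v w : 'rV[R]_m) :
  open U -> U u -> smooth_on U F ->
  v *m 'D_w (fun x => 'J F x) u = 'D_w (fun x => 'D_v F x) u.
Proof.
move=> oU Uu UF.
have dJ := smooth_on_differentiable (smooth_on_jacobian oU UF) Uu.
have mc : continuous (mulmx v : 'M[R]_(m, n) -> 'rV[R]_n).
  by move=> x; exact: linear_mx_continuous.
rewrite -(derive_linear_comp w mc dJ); apply: near_eq_derive.
apply: filterS (open_nbhs_nbhs (conj oU Uu)) => x Ux.
by rewrite deriveEjacobian //; exact: smooth_on_differentiable UF Ux.
Qed.

(** Both sides are the second derivative of [F] at [u] in the directions [v] and [w]; in this form
    symmetry enters the bracket computations. *)
Lemma mul_derive_jacobian_sym (R : realType) (m n : nat) (U : set 'rV[R]_m)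
    (F : 'rV[R]_m -> 'rV[R]_n) (u v w : 'rV[R]_m) :
  open U -> U u -> smooth_on U F ->
  v *m 'D_w (fun x => 'J F x) u = w *m 'D_v (fun x => 'J F x) u.
Proof.
move=> oU Uu UF; rewrite (mul_derive_jacobian v w oU Uu UF).
rewrite (mul_derive_jacobian w v oU Uu UF); exact: derive_mx_sym UF.
Qed.

Definition coord_bracket (R : realType) (n : nat)
    (A B : 'rV[R]_n -> 'rV[R]_n) : 'rV[R]_n -> 'rV[R]_n :=
  fun u => 'D_(A u) B u - 'D_(B u) A u.

Lemma coord_bracket_near_eq (R : realType) (n : nat)
    (A A' B B' : 'rV[R]_n -> 'rV[R]_n) (u : 'rV[R]_n) :
  (\forall w \near u, A w = A' w) -> (\forall w \near u, B w = B' w) ->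
  coord_bracket A B u = coord_bracket A' B' u.
Proof.
move=> AA BB; rewrite /coord_bracket (nbhs_singleton AA) (nbhs_singleton BB).
by rewrite (near_eq_derive _ BB) (near_eq_derive _ AA).
Qed.

(** [F]-related fields have [F]-related brackets. Each half of the bracket creates a second
    derivative of [F] along A and B, and these cancel by symmetry. *)
Lemma coord_bracket_pushforward (R : realType) (n : nat) (U : set 'rV[R]_n)
    (F A B A' B' : 'rV[R]_n -> 'rV[R]_n) (u : 'rV[R]_n) :
  open U -> U u -> smooth_on U F ->
  differentiable A u -> differentiable B u ->
  differentiable A' (F u) -> differentiable B' (F u) ->
  (\forall w \near u, A' (F w) = A w *m 'J F w) ->
  (\forall w \near u, B' (F w) = B w *m 'J F w) ->
  coord_bracket A' B' (F u) = coord_bracket A B u *m 'J F u.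
Proof.
move=> oU Uu UF.
have dF := smooth_on_differentiable UF Uu.
have dJ := smooth_on_differentiable (smooth_on_jacobian oU UF) Uu.
have half (C D C' D' : 'rV[R]_n -> 'rV[R]_n) : differentiable C u -> differentiable D u ->
    differentiable D' (F u) ->
    (\forall w \near u, C' (F w) = C w *m 'J F w) ->
    (\forall w \near u, D' (F w) = D w *m 'J F w) ->
    'D_(C' (F u)) D' (F u) =
    'D_(C u) D u *m 'J F u + D u *m 'D_(C u) (fun x => 'J F x) u.
  move=> dC dD dD' CC DD.
  rewrite (nbhs_singleton CC) -(deriveEjacobian (C u) dF) -(derive_comp (C u) dF dD').
  rewrite -derive_mulmx //; exact: near_eq_derive.
move=> dA dB dA' dB' AA BB.
rewrite /coord_bracket (half A B A' B') // (half B A B' A') //.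
rewrite (mul_derive_jacobian_sym (B u) (A u) oU Uu UF).
rewrite [RHS]mulmxBl; move: (_ *m _) (_ *m _) (_ *m _) => s a b.
by rewrite opprD addrACA subrr addr0.
Qed.

(** The directions of differentiation vary with the point, so the derivatives are rewritten as
    products with Jacobians. *)
Lemma smooth_coord_bracket (R : realType) (n : nat) (U : set 'rV[R]_n)
    (A B : 'rV[R]_n -> 'rV[R]_n) :
  open U -> smooth_on U A -> smooth_on U B -> smooth_on U (coord_bracket A B).
Proof.
move=> oU UA UB.
have smD (C D : 'rV[R]_n -> 'rV[R]_n) : smooth_on U C -> smooth_on U D ->
    smooth_on U (fun u => C u *m 'J D u).
  by move=> UC UD; apply: smooth_on_mulmx => //; exact: smooth_on_jacobian.
have smN : smooth_on U (fun u => - (B u *m 'J A u)).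
  (* Negation is multiplication by the constant 1 x 1 matrix -1. *)
  have := smooth_on_mulmx oU (@smooth_on_cst _ _ _ U (- 1%:M : 'M[R]_1)) (smD _ _ UB UA).
  apply: smooth_on_eq => //.
  by move=> u _; rewrite mulNmx mul1mx.
apply: smooth_on_eq (smooth_onD oU (smD _ _ UA UB) smN) => // u Uu.
have dA := smooth_on_differentiable UA Uu.
have dB := smooth_on_differentiable UB Uu.
by rewrite /coord_bracket (deriveEjacobian _ dA) (deriveEjacobian _ dB).
Qed.

(** In the cyclic sum each of the six products of a field with two Jacobians occurs twice with
    opposite signs, and the six second-derivative terms cancel in pairs by symmetry. *)
Lemma coord_bracket_jacobi (R : realType) (n : nat) (U : set 'rV[R]_n)
    (A B C : 'rV[R]_n -> 'rV[R]_n) (u : 'rV[R]_n) :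
  open U -> U u -> smooth_on U A -> smooth_on U B -> smooth_on U C ->
  coord_bracket A (coord_bracket B C) u + coord_bracket B (coord_bracket C A) u
  + coord_bracket C (coord_bracket A B) u = 0.
Proof.
move=> oU Uu.
have nU := open_nbhs_nbhs (conj oU Uu).
pose J (Z : 'rV[R]_n -> 'rV[R]_n) := 'J Z u.
pose S (Z : 'rV[R]_n -> 'rV[R]_n) (v w : 'rV[R]_n) : 'rV[R]_n :=
  v *m 'D_w (fun x => 'J Z x) u.
have symS Z v w : smooth_on U Z -> S Z v w = S Z w v.
  by move=> UZ; exact: (mul_derive_jacobian_sym v w oU Uu UZ).
have expand X Y Z : smooth_on U X -> smooth_on U Y -> smooth_on U Z ->
    coord_bracket X (coord_bracket Y Z) u =
    (X u *m J Y *m J Z + S Z (Y u) (X u))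
    - (X u *m J Z *m J Y + S Y (Z u) (X u))
    - (Y u *m J Z *m J X - Z u *m J Y *m J X).
  move=> UX UY UZ.
  have d (W : 'rV[R]_n -> 'rV[R]_n) : smooth_on U W -> differentiable W u.
    by move=> UW; exact: smooth_on_differentiable UW Uu.
  have dJ (W : 'rV[R]_n -> 'rV[R]_n) : smooth_on U W -> differentiable (fun x => 'J W x) u.
    by move=> UW; exact: smooth_on_differentiable (smooth_on_jacobian oU UW) Uu.
  have E : \forall x \near u,
      coord_bracket Y Z x = Y x *m 'J Z x - Z x *m 'J Y x.
    apply: filterS nU => x Ux; rewrite /coord_bracket.
    by congr (_ - _); apply: deriveEjacobian; exact: smooth_on_differentiable Ux.
  rewrite {1}/coord_bracket (near_eq_derive _ E) (nbhs_singleton E).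
  rewrite (deriveEjacobian _ (d _ UX)) mulmxBl.
  have dYZ : differentiable (fun x => Y x *m 'J Z x) u.
    by apply: differentiable_mulmx; [exact: d|exact: dJ].
  have dZY : differentiable (fun x => Z x *m 'J Y x) u.
    by apply: differentiable_mulmx; [exact: d|exact: dJ].
  rewrite (derive_subf (X u) dYZ dZY).
  congr (_ - _ - _).
    rewrite (derive_mulmx (X u) (d _ UY) (dJ _ UZ)).
    by rewrite (deriveEjacobian (X u) (d _ UY)).
  rewrite (derive_mulmx (X u) (d _ UZ) (dJ _ UY)).
  by rewrite (deriveEjacobian (X u) (d _ UZ)).
move=> UA UB UC.
rewrite (expand A B C) // (expand B C A) // (expand C A B) //.
(* Abstracting the derivatives keeps unification from unfolding them. *)
clearbody J S.
rewrite (symS C (B u)) // (symS B (C u)) // (symS A (C u)) //.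
move: (S C _ _) (S B _ _) (S A _ _) => a b c.
move: (A u *m J B *m J C) (A u *m J C *m J B) (B u *m J A *m J C)
  (B u *m J C *m J A) (C u *m J A *m J B) (C u *m J B *m J A) => p q r s t w.
by apply/rowP => k; rewrite !mxE; ring.
Qed.

Lemma lie_bracketE (R : realType) (n : nat) (M : manifold R n)
    (X Y : M -> 'rV[R]_n) (x : M) :
  lie_bracket X Y x = coord_bracket (vcomp (chart_at x) X \o chartV (chart_at x))
    (vcomp (chart_at x) Y \o chartV (chart_at x)) (chart_map (chart_at x) x).
Proof.
rewrite /coord_bracket /= chart_mapK; last exact: dom_chart_at.
by rewrite !vcomp_at.
Qed.

Lemma vector_field_chart (R : realType) (n : nat) (M : manifold R n)
    (X : M -> 'rV[R]_n) (i : chart M) : vector_field X ->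
  smooth_on (chart_map i @` dom i) (vcomp i X \o chartV i).
Proof.
by move=> /(_ i i) /=; apply: smooth_on_sub; apply: image_subset => x ix.
Qed.

Lemma vector_fieldP (R : realType) (n : nat) (M : manifold R n)
    (X : M -> 'rV[R]_n) :
  (forall i : chart M, smooth_on (chart_map i @` dom i) (vcomp i X \o chartV i)) ->
  vector_field X.
Proof.
move=> Xs i; apply: (msmooth_on_chart (i := i)) => //; first exact: open_dom.
exact: Xs.
Qed.

(** The right-hand side is one formula on the whole of [dom i], whereas the bracket is defined with
    a chart that changes with [x]. The transition map from [chart_at x] to [i] relates the two pairs
    of component fields. *)
Lemma lie_bracket_chart (R : realType) (n : nat) (M : manifold R n)
    (X Y : M -> 'rV[R]_n) (i : chart M) (x : M) :
  vector_field X -> vector_field Y -> dom i x ->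
  vcomp i (lie_bracket X Y) x =
  coord_bracket (vcomp i X \o chartV i) (vcomp i Y \o chartV i) (chart_map i x).
Proof.
move=> sX sY ix.
have cx := @dom_chart_at _ _ M x; set c := chart_at x in cx *.
pose F := chart_map i \o chartV c.
have FE : F (chart_map c x) = chart_map i x by rewrite /F /= chart_mapK.
have Uc : (chart_map c @` (dom c `&` dom i)) (chart_map c x) by exists x.
have dZ (Z : M -> 'rV[R]_n) (j : chart M) : vector_field Z -> dom j x ->
    differentiable (vcomp j Z \o chartV j) (chart_map j x).
  move=> sZ jx; apply: smooth_on_differentiable (vector_field_chart j sZ) _.
  by exists x.
have push (Z : M -> 'rV[R]_n) : \forall w \near chart_map c x,
    (vcomp i Z \o chartV i) (F w) = (vcomp c Z \o chartV c) w *m 'J F w.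
  apply: filterS (near_chart (@open_dom _ _ _ i) ix cx) => w [iw cw wE].
  have E1 : (vcomp i Z \o chartV i) (F w) = vcomp i Z (chartV c w).
    by rewrite /F /comp (chart_mapK iw).
  have E2 : 'J F w = jac c i (chartV c w).
    by rewrite jacE /comp wE.
  apply: (etrans E1); rewrite E2.
  exact: vcomp_change.
rewrite {1}/vcomp lie_bracketE -FE.
apply/esym; apply: (coord_bracket_pushforward (U := chart_map c @` (dom c `&` dom i))) => //.
- exact: open_chart_overlap.
- exact: chart_change_smooth.
- exact: dZ.
- exact: dZ.
- by rewrite FE; exact: dZ.
- by rewrite FE; exact: dZ.
Qed.

Lemma vector_field_lie_bracket (R : realType) (n : nat) (M : manifold R n)
    (X Y : M -> 'rV[R]_n) :
  vector_field X -> vector_field Y -> vector_field (lie_bracket X Y).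
Proof.
move=> sX sY; apply: vector_fieldP => i.
have oi : open (chart_map i @` dom i) by exact: open_codom.
have := smooth_coord_bracket oi (vector_field_chart i sX) (vector_field_chart i sY).
apply: smooth_on_eq => // _ [x ix <-].
by rewrite -(lie_bracket_chart sX sY ix) /comp (chart_mapK ix).
Qed.

Lemma lie_bracket_jacobi (R : realType) (n : nat) (M : manifold R n)
    (X Y Z : M -> 'rV[R]_n) (x : M) :
  vector_field X -> vector_field Y -> vector_field Z ->
  lie_bracket X (lie_bracket Y Z) x + lie_bracket Y (lie_bracket Z X) x
  + lie_bracket Z (lie_bracket X Y) x = 0.
Proof.
have cx := @dom_chart_at _ _ M x.
(* The inner bracket is differentiated, so it is needed at points near [x], each with its own
   preferred chart; [lie_bracket_chart] brings all of them to the chart at [x]. *)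
have nest (X' Y' Z' : M -> 'rV[R]_n) : vector_field Y' -> vector_field Z' ->
    lie_bracket X' (lie_bracket Y' Z') x =
    coord_bracket (vcomp (chart_at x) X' \o chartV (chart_at x))
      (coord_bracket (vcomp (chart_at x) Y' \o chartV (chart_at x))
        (vcomp (chart_at x) Z' \o chartV (chart_at x)))
      (chart_map (chart_at x) x).
  move=> sY sZ; rewrite lie_bracketE; apply: coord_bracket_near_eq.
    exact: filterE.
  apply: filterS (near_chart openT I cx) => u [_ cu uE] /=.
  by rewrite (lie_bracket_chart sY sZ cu) uE.
move=> sX sY sZ; rewrite (nest X) // (nest Y) // (nest Z) //.
have o : open (chart_map (chart_at x) @` dom (chart_at x)) by exact: open_codom.
by apply: (coord_bracket_jacobi o); [exists x|exact: vector_field_chart..].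
Qed.

(** * Lie algebroids *)

Lemma coord_bracketC (R : realType) (n : nat) (A B : 'rV[R]_n -> 'rV[R]_n)
    (u : 'rV[R]_n) : coord_bracket A B u = - coord_bracket B A u.
Proof. by rewrite /coord_bracket opprB. Qed.

Lemma coord_bracket_linearl (R : realType) (n : nat) (c : R)
    (A A' B : 'rV[R]_n -> 'rV[R]_n) (u : 'rV[R]_n) :
  differentiable A u -> differentiable A' u -> differentiable B u ->
  coord_bracket (fun w => c *: A w + A' w) B u
  = c *: coord_bracket A B u + coord_bracket A' B u.
Proof.
move=> dA dA' dB; rewrite /coord_bracket (derive_linear_dir dB).
have dcA : differentiable (fun w => c *: A w) u by exact: differentiableZ.
rewrite (derive_addf _ dcA dA').
have -> : 'D_(B u) (fun w => c *: A w) u = c *: 'D_(B u) A u.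
  by apply: deriveZ; exact: diff_derivable.
by rewrite scalerBr opprD addrACA.
Qed.

Lemma coord_bracket_leibniz (R : realType) (n : nat) (phi : 'rV[R]_n -> R^o)
    (A B : 'rV[R]_n -> 'rV[R]_n) (u : 'rV[R]_n) :
  differentiable phi u -> differentiable A u -> differentiable B u ->
  coord_bracket A (fun w => phi w *: B w) u
  = phi u *: coord_bracket A B u + 'D_(A u) phi u *: B u.
Proof.
move=> dphi dA dB; rewrite /coord_bracket (derive_scale _ dphi dB).
have -> : 'D_(phi u *: B u) A u = phi u *: 'D_(B u) A u.
  have := derive_linear_dir dA (phi u) (B u) 0.
  by rewrite addr0 derive0 addr0.
by rewrite scalerBr -addrA addrC.
Qed.

Lemma vcomp_linear (R : realType) (n : nat) (M : manifold R n) (i : chart M)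
    (c : R) (X Y : M -> 'rV[R]_n) :
  vcomp i (fun y => c *: X y + Y y) \o chartV i =
  (fun w => c *: (vcomp i X \o chartV i) w + (vcomp i Y \o chartV i) w).
Proof. by apply/funext => w; rewrite /vcomp /= mulmxDl scalemxAl. Qed.

Lemma tangent_lie_algebroid (R : realType) (n : nat) (M : manifold R n) :
  is_lie_algebroid (tangent_algebroid M).
Proof.
have dX (X : M -> 'rV[R]_n) (x : M) : vector_field X ->
    differentiable (vcomp (chart_at x) X \o chartV (chart_at x))
      (chart_map (chart_at x) x).
  move=> sX; apply: smooth_on_differentiable (vector_field_chart _ sX) _.
  by exists x => //; exact: dom_chart_at.
have linl (c : R) (X X' Y : M -> 'rV[R]_n) (x : M) :
    vector_field X -> vector_field X' -> vector_field Y ->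
    lie_bracket (fun y => c *: X y + X' y) Y x =
    c *: lie_bracket X Y x + lie_bracket X' Y x.
  move=> sX sX' sY; rewrite !lie_bracketE vcomp_linear.
  by apply: coord_bracket_linearl; exact: dX.
have antiC (X Y : M -> 'rV[R]_n) (x : M) : lie_bracket X Y x = - lie_bracket Y X x.
  by rewrite !lie_bracketE coord_bracketC.
split; last by move=> X Y Z sX sY sZ x; exact: lie_bracket_jacobi.
split.
- exact: is_vbundle_tangent.
(* The local matrices of the identity anchor are the transition matrices of the bundle. *)
- by split=> // t s; have [_ _ _] := is_vbundle_tangent M; apply.
- exact: vector_field_lie_bracket.
- by move=> X _ x; rewrite /= /lie_bracket subrr.
- by move=> c X X' Y sX sX' sY x; exact: linl.
- move=> c X Y Y' sX sY sY' x.
  rewrite [LHS]antiC [lie_bracket _ _ x]linl // opprD -scalerN.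
  by congr (_ *: _ + _); rewrite -antiC.
- move=> phi X Y sphi sX sY x /=.
  have cx := @dom_chart_at _ _ M x.
  have dphi : differentiable ((phi : M -> R^o) \o chartV (chart_at x))
      (chart_map (chart_at x) x).
    by apply: smooth_on_differentiable (sphi (chart_at x)) _; exists x.
  rewrite !lie_bracketE.
  have -> : vcomp (chart_at x) (fun y => phi y *: Y y) \o chartV (chart_at x) =
      (fun w => ((phi : M -> R^o) \o chartV (chart_at x)) w *:
         (vcomp (chart_at x) Y \o chartV (chart_at x)) w).
    by apply/funext => w; rewrite /vcomp /= scalemxAl.
  rewrite (coord_bracket_leibniz dphi (dX _ _ sX) (dX _ _ sY)).
  by rewrite /comp (chart_mapK cx) !vcomp_at.
Qed.

(** * Smooth sections, and transport of the axioms along an isomorphism *)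

Lemma msmooth_on_scale (R : realType) (n : nat) (M : manifold R n)
    (W : normedModType R) (U : set M) (phi : M -> R^o) (f : M -> W) : open U ->
  msmooth_on U phi -> msmooth_on U f -> msmooth_on U (fun x => phi x *: f x).
Proof.
move=> oU Uphi Uf i k; apply: (@Ck_on_bilin _ _ R^o W W _ _ *:%R).
- exact: open_chart_image.
- exact: scale_continuous.
- exact: (Uphi i k).
- exact: (Uf i k).
Qed.

Lemma msmooth_on_cst (R : realType) (n : nat) (M : manifold R n)
    (W : normedModType R) (U : set M) (c : W) : msmooth_on U (fun=> c).
Proof. by move=> i; exact: smooth_on_cst. Qed.

Lemma smooth_section_linear (R : realType) (n : nat) (M : manifold R n)
    (E : vbundle M) (phi : M -> R^o) (s t : msection E) :
  is_vbundle E -> msmooth phi -> smooth_section s -> smooth_section t ->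
  smooth_section (fun x => phi x *: s x + t x).
Proof.
move=> [oE _ linE _] sphi ss st r.
have Uphi : msmooth_on (tdom r) phi by apply: msmooth_on_sub sphi.
apply: (msmooth_on_eq (oE r) _
  (msmooth_onD (oE r) (msmooth_on_scale (oE r) Uphi (ss r)) (st r))).
by move=> x rx; rewrite (linE r x rx).1.
Qed.

Lemma smooth_section_scale (R : realType) (n : nat) (M : manifold R n)
    (E : vbundle M) (phi : M -> R^o) (s : msection E) :
  is_vbundle E -> msmooth phi -> smooth_section s ->
  smooth_section (fun x => phi x *: s x).
Proof.
move=> [oE _ linE _] sphi ss r.
have Uphi : msmooth_on (tdom r) phi by apply: msmooth_on_sub sphi.
apply: (msmooth_on_eq (oE r) _ (msmooth_on_scale (oE r) Uphi (ss r))) => x rx.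
have := (linE r x rx).1 (phi x) (s x) 0; rewrite addr0 => ->.
(* Linearity with coefficient -1 at zero vectors shows that the trivialization maps 0 to 0. *)
have := (linE r x rx).1 (-1) 0 0.
by rewrite scaler0 scaleN1r addr0 addNr => ->; rewrite addr0.
Qed.

(** On smooth sections the bracket of [A] is that of [B] pulled back by [f], so each bracket axiom
    is checked after applying the injective map [f]. An isomorphism matches brackets of smooth
    sections only, hence the smoothness checks at each use of [fbr]. *)
Lemma lie_algebroid_iso (R : realType) (n : nat) (M : manifold R n)
    (A B : algebroid M) : is_vbundle (abundle A) ->
  vb_morphism (@anchor _ _ _ A) -> algebroid_iso A B -> is_lie_algebroid B ->
  is_lie_algebroid A.
Proof.
move=> vA anA [f [g [fm gm fgK fan fbr]]] [skB jacB].
have vB := skew_vbundle skB.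
have fs s : smooth_section s -> smooth_section (fun x => f x (s x)).
  exact: vb_morphism_section.
have gs s : smooth_section s -> smooth_section (fun x => g x (s x)).
  exact: vb_morphism_section.
(* An equality of sections, from which smoothness of the bracket is inherited through [g]. *)
have brE (s t : msection (abundle A)) : smooth_section s -> smooth_section t ->
    abracket s t =
    (fun x => g x (abracket (fun y => f y (s y)) (fun y => f y (t y)) x)).
  by move=> ss st; apply: functional_extensionality_dep => x; rewrite -fbr // (fgK x).1.
have brs (s t : msection (abundle A)) : smooth_section s -> smooth_section t ->
    smooth_section (abracket s t).
  move=> ss st; rewrite brE //; apply: gs; apply: (skew_closed skB); exact: fs.
have inj x (a b : abundle A x) : f x a = f x b -> a = b.
  exact: (can_inj (fgK x).1).
have lin x := fm.1 x.
have flin x c (a b : abundle A x) : f x (c *: a + b) = c *: f x a + f x b.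
  exact: lin.
have f0 x : f x 0 = 0.
  have := flin x (-1) 0 0.
  by rewrite scaler0 addr0 scaleN1r addNr.
have fD x (a b : abundle A x) : f x (a + b) = f x a + f x b.
  by have := flin x 1 a b; rewrite !scale1r.
have fZ x c (a : abundle A x) : f x (c *: a) = c *: f x a.
  by have := flin x c a 0; rewrite !addr0 f0 addr0.
split.
  split => //.
  - move=> s ss x; apply: inj; rewrite f0 fbr //.
    exact: (skew_alternating skB (fs _ ss)).
  - move=> c s s' t ss ss' st x; apply: inj.
    have scs : smooth_section (fun y => c *: s y + s' y).
      by apply: smooth_section_linear => //; exact: msmooth_on_cst.
    rewrite flin (fbr s t) // (fbr s' t) // (fbr _ t) //.
    rewrite -(skew_linearl skB) //; [|exact: fs..].
    congr (abracket _ _ x).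
    by apply: functional_extensionality_dep => y; rewrite flin.
  - move=> c s t t' ss st st' x; apply: inj.
    have sct : smooth_section (fun y => c *: t y + t' y).
      by apply: smooth_section_linear => //; exact: msmooth_on_cst.
    rewrite flin (fbr s t) // (fbr s t') // (fbr s _) //.
    rewrite -(skew_linearr skB) //; [|exact: fs..].
    congr (abracket _ _ x).
    by apply: functional_extensionality_dep => y; rewrite flin.
  - move=> phi s t sphi ss st x; apply: inj.
    have sct : smooth_section (fun y => phi y *: t y).
      exact: smooth_section_scale.
    rewrite fD !fZ (fbr s t) // (fbr s _) // -fan.
    rewrite -(skew_leibniz skB sphi (fs _ ss) (fs _ st)).
    congr (abracket _ _ x).
    by apply: functional_extensionality_dep => y; rewrite fZ.
move=> s t u ss st su x; apply: inj.
rewrite f0 !fD.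
have fbr2 (a b c : msection (abundle A)) : smooth_section a ->
    smooth_section b -> smooth_section c ->
    f x (abracket a (abracket b c) x) =
    abracket (fun y => f y (a y))
      (abracket (fun y => f y (b y)) (fun y => f y (c y))) x.
  move=> sa sb sc; rewrite fbr //; last exact: brs.
  congr (abracket _ _ x).
  by apply: functional_extensionality_dep => y; rewrite fbr.
rewrite !fbr2 //; apply: jacB; exact: fs.
Qed.

(** * Pointwise linear algebra *)

Lemma pairing_linearl (R : realType) (n : nat) (a b : 'cV[R]_n) (c : R)
    (v : 'rV[R]_n) : pairing (c *: a + b) v = c * pairing a v + pairing b v.
Proof. by rewrite /pairing mulmxDr -scalemxAr !mxE. Qed.

Lemma pairingDl (R : realType) (n : nat) (a b : 'cV[R]_n) (v : 'rV[R]_n) :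
  pairing (a + b) v = pairing a v + pairing b v.
Proof. by rewrite /pairing mulmxDr !mxE. Qed.

Lemma pairingBl (R : realType) (n : nat) (a b : 'cV[R]_n) (v : 'rV[R]_n) :
  pairing (a - b) v = pairing a v - pairing b v.
Proof. by rewrite /pairing mulmxBr !mxE. Qed.

Lemma pairingZl (R : realType) (n : nat) (c : R) (a : 'cV[R]_n) (v : 'rV[R]_n) :
  pairing (c *: a) v = c * pairing a v.
Proof. by rewrite /pairing -scalemxAr !mxE. Qed.

Lemma pairingDr (R : realType) (n : nat) (a : 'cV[R]_n) (v w : 'rV[R]_n) :
  pairing a (v + w) = pairing a v + pairing a w.
Proof. by rewrite /pairing mulmxDl !mxE. Qed.

Lemma pairingBr (R : realType) (n : nat) (a : 'cV[R]_n) (v w : 'rV[R]_n) :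
  pairing a (v - w) = pairing a v - pairing a w.
Proof. by rewrite /pairing mulmxBl !mxE. Qed.

Lemma pairingZr (R : realType) (n : nat) (c : R) (a : 'cV[R]_n) (v : 'rV[R]_n) :
  pairing a (c *: v) = c * pairing a v.
Proof. by rewrite /pairing -scalemxAl !mxE. Qed.

Lemma pairing_inj (R : realType) (n : nat) (a b : 'cV[R]_n) :
  (forall v, pairing a v = pairing b v) -> a = b.
Proof.
move=> ab; apply: mulmx_rV_inj => v.
by apply/matrixP => i j; rewrite !ord1; exact: ab.
Qed.

(** Turns a rank-one map into a matrix product, from which the local matrix of a bundle morphism can
    be read off. *)
Lemma pairingZ_rV (R : realType) (n : nat) (a : 'cV[R]_n) (v w : 'rV[R]_n) :
  pairing a v *: w = (v *m a) *m w.
Proof. by rewrite [in RHS](mx11_scalar (v *m a)) mul_scalar_mx. Qed.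

Lemma pairingZ_cV (R : realType) (n : nat) (a b : 'cV[R]_n) (v : 'rV[R]_n) :
  pairing a v *: b = b *m (v *m a).
Proof. by rewrite [in RHS](mx11_scalar (v *m a)) mul_mx_scalar. Qed.

Lemma mxN00 (R : realType) (A : 'M[R]_1) : (- A) 0 0 = - A 0 0.
Proof. by rewrite mxE. Qed.

Lemma pairing_trmx (R : realType) (n : nat) (a : 'cV[R]_n) (v : 'rV[R]_n) :
  pairing a v = (a^T *m v^T) 0 0.
Proof. by rewrite -trmx_mul mxE. Qed.

(** Polarization on sums of two basis vectors. *)
Lemma ev2_alternating_trmx (R : realType) (n : nat) (w : 'M[R]_n) :
  (forall v, ev2 w v v = 0) -> w^T = - w.
Proof.
move=> alt; apply/matrixP => i j; rewrite !mxE.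
have entry k l : ev2 w (delta_mx 0 k) (delta_mx 0 l) = w k l.
  by rewrite /ev2 trmx_delta -rowE -colE !mxE.
have := alt (delta_mx 0 i + delta_mx 0 j).
have -> : ev2 w (delta_mx 0 i + delta_mx 0 j) (delta_mx 0 i + delta_mx 0 j) =
    ev2 w (delta_mx 0 i) (delta_mx 0 i) + ev2 w (delta_mx 0 i) (delta_mx 0 j)
    + (ev2 w (delta_mx 0 j) (delta_mx 0 i) + ev2 w (delta_mx 0 j) (delta_mx 0 j)).
  rewrite /ev2 [(_ + _)^T]linearD /= !mulmxDl !mulmxDr.
  by move: (_ *m _) (_ *m _) (_ *m _) (_ *m _) => a b c d; rewrite !mxE; ring.
by rewrite !alt !entry add0r addr0 addrC => /eqP; rewrite addr_eq0 => /eqP.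
Qed.

(* The inverse of [sharp_jacobi]: v |-> theta(v) theta - i_v omega. *)
Definition flat_jacobi (R : realType) (n : nat) (om : 'M[R]_n) (th : 'cV[R]_n)
    (v : 'rV[R]_n) : 'cV[R]_n := pairing th v *: th + om *m v^T.

(** The anchor on bare matrices, so that it applies to components in any chart. *)
Definition sharp_jacobi_at (R : realType) (n : nat) (p : 'M[R]_n)
    (xi : 'rV[R]_n) (a : 'cV[R]_n) : 'rV[R]_n := sharp p a + pairing a xi *: xi.

(** The pointwise relations between the four tensors as matrix identities. They are stable under
    change of basis ([lcs_at_change]), hence hold for the components in a fixed chart at all points
    near [x] and can be differentiated. *)
Record lcs_at (R : realType) (n : nat) (om : 'M[R]_n) (th : 'cV[R]_n)
    (p : 'M[R]_n) (xi : 'rV[R]_n) : Prop := LcsAt {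
  lcs_at_skew : om^T = - om ;
  lcs_at_inv : p *m om = - 1%:M ;
  lcs_at_xi : xi *m om = - th^T
}.

Lemma lcs_at_invC (R : realType) (n : nat) (om p : 'M[R]_n) (th : 'cV[R]_n)
    (xi : 'rV[R]_n) : lcs_at om th p xi -> om *m p = - 1%:M.
Proof.
move=> h; have : (- p) *m om = 1%:M by rewrite mulNmx (lcs_at_inv h) opprK.
by move=> /mulmx1C; rewrite mulmxN => /eqP; rewrite eqr_oppLR => /eqP.
Qed.

Lemma lcs_at_skewp (R : realType) (n : nat) (om p : 'M[R]_n) (th : 'cV[R]_n)
    (xi : 'rV[R]_n) : lcs_at om th p xi -> p^T = - p.
Proof.
move=> h; have omp := lcs_at_invC h.
have : om *m p^T = 1%:M.
  apply: trmx_inj; rewrite trmx_mul trmxK (lcs_at_skew h) mulmxN (lcs_at_inv h).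
  by rewrite opprK trmx1.
move=> /(congr1 (mulmx p)); rewrite mulmxA (lcs_at_inv h) mulNmx mul1mx mulmx1.
by move=> /eqP; rewrite eqr_oppLR => /eqP.
Qed.

Lemma lcs_at_xiE (R : realType) (n : nat) (om p : 'M[R]_n) (th : 'cV[R]_n)
    (xi : 'rV[R]_n) : lcs_at om th p xi -> xi = th^T *m p.
Proof.
move=> h; have /(congr1 (mulmx^~ p)) := lcs_at_xi h.
rewrite -mulmxA (lcs_at_invC h) mulmxN mulmx1 mulNmx => /eqP.
by rewrite eqr_opp => /eqP.
Qed.

(** theta(xi) = p(theta, theta), which equals its opposite because [p] is skew. *)
Lemma lcs_at_theta_xi (R : realType) (n : nat) (om p : 'M[R]_n)
    (th : 'cV[R]_n) (xi : 'rV[R]_n) : lcs_at om th p xi -> pairing th xi = 0.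
Proof.
move=> h; apply/eqP; rewrite -[_ == _](mulrn_eq0 _ 2) mulr2n addr_eq0.
rewrite {2}pairing_trmx (lcs_at_xiE h) trmx_mul trmxK (lcs_at_skewp h).
by rewrite mulNmx mulmxN mulmxA /pairing mxN00 opprK.
Qed.

Lemma om_xi (R : realType) (n : nat) (om p : 'M[R]_n) (th : 'cV[R]_n)
    (xi : 'rV[R]_n) : lcs_at om th p xi -> om *m xi^T = th.
Proof.
move=> h; apply: trmx_inj.
by rewrite trmx_mul trmxK (lcs_at_skew h) mulmxN (lcs_at_xi h) opprK.
Qed.

(** a(xi) = p(theta, a) = -p(a, theta) = -theta(sharp a), and theta(xi) = 0 allows the term a(xi) xi
    to be added. *)
Lemma pairing_xi (R : realType) (n : nat) (om p : 'M[R]_n) (th : 'cV[R]_n)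
    (xi : 'rV[R]_n) (a : 'cV[R]_n) : lcs_at om th p xi ->
  pairing a xi = - pairing th (sharp_jacobi_at p xi a).
Proof.
move=> h; rewrite /sharp_jacobi_at pairingDr pairingZr (lcs_at_theta_xi h).
rewrite mulr0 addr0 pairing_trmx {1}(lcs_at_xiE h) trmx_mul trmxK.
by rewrite (lcs_at_skewp h) mulNmx mulmxN mxN00 mulmxA.
Qed.

(** With X the image of a, theta(X) theta = -a(xi) theta cancels the contribution of a(xi) xi
    through [om], and [om] sends sharp a back to a. *)
Lemma sharp_jacobiK (R : realType) (n : nat) (om p : 'M[R]_n) (th : 'cV[R]_n)
    (xi : 'rV[R]_n) : lcs_at om th p xi ->
  cancel (sharp_jacobi_at p xi) (flat_jacobi om th).
Proof.
move=> h a; rewrite /flat_jacobi -[pairing th _]opprK -(pairing_xi _ h) scaleNr.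
rewrite /sharp_jacobi_at [(_ + _)^T]linearD /= [(_ *: _)^T]linearZ /=.
rewrite mulmxDr -scalemxAr (om_xi h).
rewrite /sharp trmx_mul trmxK (lcs_at_skewp h) mulNmx mulmxN mulmxA.
by rewrite (lcs_at_invC h) mulNmx mul1mx opprK addrC addrK.
Qed.

Lemma flat_jacobiK (R : realType) (n : nat) (om p : 'M[R]_n) (th : 'cV[R]_n)
    (xi : 'rV[R]_n) : lcs_at om th p xi ->
  cancel (flat_jacobi om th) (sharp_jacobi_at p xi).
Proof.
move=> h v; rewrite /sharp_jacobi_at /flat_jacobi.
rewrite pairingDl pairingZl (lcs_at_theta_xi h) mulr0 add0r.
have -> : pairing (om *m v^T) xi = - pairing th v.
  by rewrite /pairing mulmxA (lcs_at_xi h) mulNmx mxN00 -trmx_mul [_^T 0 0]mxE.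
rewrite /sharp [(_ + _)^T]linearD /= [(_ *: _)^T]linearZ /=.
rewrite mulmxDl -scalemxAl -(lcs_at_xiE h) scaleNr.
rewrite trmx_mul trmxK (lcs_at_skew h) mulmxN mulNmx -mulmxA (lcs_at_invC h).
by rewrite mulmxN mulmx1 opprK addrAC subrr add0r.
Qed.

Lemma pairing_mulmx_trmx (R : realType) (n : nat) (w : 'M[R]_n)
    (v z : 'rV[R]_n) : pairing (w *m v^T) z = ev2 w z v.
Proof. by rewrite /ev2 -mulmxA. Qed.

Lemma pairing_flat (R : realType) (n : nat) (om : 'M[R]_n) (th : 'cV[R]_n)
    (v w : 'rV[R]_n) :
  pairing (flat_jacobi om th v) w = pairing th v * pairing th w + ev2 om w v.
Proof. by rewrite /flat_jacobi pairingDl pairingZl pairing_mulmx_trmx. Qed.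

(** b(X) is computed twice: from b = flat Y it is theta(X) theta(Y) + om(X, Y), from the formula for
    X it is p(a, b) + a(xi) b(xi), and a(xi) b(xi) = theta(X) theta(Y). *)
Lemma cev2_ev2 (R : realType) (n : nat) (om p : 'M[R]_n) (th : 'cV[R]_n)
    (xi : 'rV[R]_n) (a b : 'cV[R]_n) : lcs_at om th p xi ->
  cev2 p a b = ev2 om (sharp_jacobi_at p xi a) (sharp_jacobi_at p xi b).
Proof.
move=> h; set X := sharp_jacobi_at p xi a; set Y := sharp_jacobi_at p xi b.
have : pairing (flat_jacobi om th Y) X = pairing b X by rewrite (sharp_jacobiK h).
rewrite pairing_flat => E.
have -> : ev2 om X Y = pairing b X - pairing th Y * pairing th X.
  by rewrite -E addrC addKr.
have xiX := pairing_xi a h; have xiY := pairing_xi b h.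
rewrite {1}/X /sharp_jacobi_at pairingDr pairingZr pairing_sharp xiX xiY.
by rewrite mulrN mulNr opprK mulrC addrK.
Qed.

(** * The Jacobi bracket in coordinates *)

Lemma differentiable_mx_entry (R : realType) (V : normedModType R) (m n : nat)
    (f : V -> 'M[R]_(m, n)) (i : 'I_m) (j : 'I_n) (x : V) :
  differentiable f x -> differentiable (fun y => f y i j : R^o) x.
Proof.
move=> df; apply: (differentiable_linear_comp (L := mx_entry i j) _ df) => y.
exact: linear_mx_continuous.
Qed.

Lemma derive_mx_entry (R : realType) (V : normedModType R) (m n : nat)
    (f : V -> 'M[R]_(m, n)) (i : 'I_m) (j : 'I_n) (x v : V) :
  differentiable f x -> 'D_v (fun y => f y i j : R^o) x = ('D_v f x) i j.
Proof.
move=> df; apply: (derive_linear_comp (L := mx_entry i j) v _ df) => y.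
exact: linear_mx_continuous.
Qed.

Lemma differentiable_trmx (R : realType) (V : normedModType R) (m n : nat)
    (f : V -> 'M[R]_(m, n)) (x : V) :
  differentiable f x -> differentiable (fun y => (f y)^T) x.
Proof.
move=> df; apply: (differentiable_linear_comp (L := trmx) _ df) => y.
exact: linear_mx_continuous.
Qed.

Lemma derive_trmx (R : realType) (V : normedModType R) (m n : nat)
    (f : V -> 'M[R]_(m, n)) (x v : V) :
  differentiable f x -> 'D_v (fun y => (f y)^T) x = ('D_v f x)^T.
Proof.
move=> df; apply: (derive_linear_comp (L := trmx) v _ df) => y.
exact: linear_mx_continuous.
Qed.

Lemma differentiable_pairing (R : realType) (V : normedModType R) (n : nat)
    (a : V -> 'cV[R]_n) (X : V -> 'rV[R]_n) (x : V) :
  differentiable a x -> differentiable X x ->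
  differentiable (fun y => pairing (a y) (X y) : R^o) x.
Proof.
move=> da dX; apply: (differentiable_mx_entry 0 0); exact: differentiable_mulmx.
Qed.

Lemma derive_pairing (R : realType) (V : normedModType R) (n : nat)
    (a : V -> 'cV[R]_n) (X : V -> 'rV[R]_n) (x v : V) :
  differentiable a x -> differentiable X x ->
  'D_v (fun y => pairing (a y) (X y) : R^o) x =
  pairing ('D_v a x) (X x) + pairing (a x) ('D_v X x).
Proof.
move=> da dX; have dXa := differentiable_mulmx dX da.
rewrite (derive_mx_entry 0 0 v dXa) (derive_mulmx v dX da) /pairing.
by rewrite mxE addrC.
Qed.

Lemma derive_ev2 (R : realType) (V : normedModType R) (n : nat)
    (w : V -> 'M[R]_n) (X Y : V -> 'rV[R]_n) (x v : V) :
  differentiable w x -> differentiable X x -> differentiable Y x ->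
  'D_v (fun y => ev2 (w y) (X y) (Y y) : R^o) x =
  ev2 ('D_v w x) (X x) (Y x) + ev2 (w x) ('D_v X x) (Y x)
  + ev2 (w x) (X x) ('D_v Y x).
Proof.
move=> dw dX dY.
have dXw := differentiable_mulmx dX dw.
have dYT := differentiable_trmx dY.
have dXwY := differentiable_mulmx dXw dYT.
rewrite (derive_mx_entry 0 0 v dXwY) (derive_mulmx v dXw dYT).
rewrite (derive_mulmx v dX dw) (derive_trmx v dY) /ev2 mulmxDl.
move: (_ *m _) (_ *m _) (_ *m _) => a b c; rewrite !mxE; ring.
Qed.

Definition coord_lie_form (R : realType) (n : nat) (X : 'rV[R]_n -> 'rV[R]_n)
    (b : 'rV[R]_n -> 'cV[R]_n) : 'rV[R]_n -> 'cV[R]_n :=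
  fun u => 'D_(X u) b u + \col_k pairing (b u) ('D_(delta_mx 0 k) X u).

(** The forms in the main identity are compared on a constant vector [z], where components give way
    to derivatives along [z]. *)
Lemma pairing_coord_lie_form (R : realType) (n : nat)
    (X : 'rV[R]_n -> 'rV[R]_n) (b : 'rV[R]_n -> 'cV[R]_n) (u z : 'rV[R]_n) :
  differentiable X u ->
  pairing (coord_lie_form X b u) z =
  pairing ('D_(X u) b u) z + pairing (b u) ('D_z X u).
Proof.
move=> dX; rewrite /coord_lie_form pairingDl; congr (_ + _).
rewrite (derive_sum_delta z dX) /pairing mulmx_suml summxE mxE.
by apply: eq_bigr => k _; rewrite -scalemxAl !mxE.
Qed.

Definition coord_ext_d0 (R : realType) (n : nat) (f : 'rV[R]_n -> R^o) :
    'rV[R]_n -> 'cV[R]_n := fun u => \col_k 'D_(delta_mx 0 k) f u.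

Lemma pairing_coord_ext_d0 (R : realType) (n : nat) (f : 'rV[R]_n -> R^o)
    (u z : 'rV[R]_n) : differentiable f u ->
  pairing (coord_ext_d0 f u) z = 'D_z f u.
Proof.
move=> df; rewrite (derive_sum_delta z df) /pairing mxE.
by apply: eq_bigr => k _; rewrite mxE.
Qed.

Definition coord_jacobi_bracket (R : realType) (n : nat)
    (P : 'rV[R]_n -> 'M[R]_n) (Xi : 'rV[R]_n -> 'rV[R]_n)
    (Th A B : 'rV[R]_n -> 'cV[R]_n) : 'rV[R]_n -> 'cV[R]_n :=
  fun u => coord_lie_form (fun w => sharp (P w) (A w)) B u
    - coord_lie_form (fun w => sharp (P w) (B w)) A u
    - coord_ext_d0 (fun w => cev2 (P w) (A w) (B w)) u
    + pairing (A u) (Xi u) *: (coord_lie_form Xi B u - B u)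
    - pairing (B u) (Xi u) *: (coord_lie_form Xi A u - A u)
    - cev2 (P u) (A u) (B u) *: Th u.

Lemma differentiable_sharp_jacobi_at (R : realType) (V : normedModType R)
    (n : nat) (P : V -> 'M[R]_n) (Xi : V -> 'rV[R]_n) (A : V -> 'cV[R]_n)
    (x : V) : differentiable P x -> differentiable Xi x -> differentiable A x ->
  differentiable (fun w => sharp_jacobi_at (P w) (Xi w) (A w)) x.
Proof.
move=> dP dXi dA; apply: differentiableD.
  by apply: differentiable_mulmx => //; exact: differentiable_trmx.
by apply: differentiable_scale => //; exact: differentiable_pairing.
Qed.

Lemma derive_flat_jacobi (R : realType) (V : normedModType R) (n : nat)
    (om : V -> 'M[R]_n) (th : V -> 'cV[R]_n) (X : V -> 'rV[R]_n) (x v : V)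
    (z : 'rV[R]_n) :
  differentiable om x -> differentiable th x -> differentiable X x ->
  pairing ('D_v (fun y => flat_jacobi (om y) (th y) (X y)) x) z =
  (pairing ('D_v th x) (X x) + pairing (th x) ('D_v X x)) * pairing (th x) z
  + pairing (th x) (X x) * pairing ('D_v th x) z
  + ev2 ('D_v om x) z (X x) + ev2 (om x) z ('D_v X x).
Proof.
move=> dom dth dX.
have dp := differentiable_pairing dth dX.
have dpt := differentiable_scale dp dth.
have dXT := differentiable_trmx dX.
have doX := differentiable_mulmx dom dXT.
rewrite (derive_addf v dpt doX) (derive_scale v dp dth) (derive_mulmx v dom dXT).
rewrite (derive_pairing v dth dX) (derive_trmx v dX) !pairingDl !pairingZl.
by rewrite !pairing_mulmx_trmx addrA.
Qed.

(* L_X b = L_(sharp a) b + a(xi) L_xi b + b(xi) d(a(xi)) for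
   X = sharp a + a(xi) xi. *)
Lemma pairing_lie_form_sharp (R : realType) (n : nat)
    (P : 'rV[R]_n -> 'M[R]_n) (Xi : 'rV[R]_n -> 'rV[R]_n)
    (A B : 'rV[R]_n -> 'cV[R]_n) (u z : 'rV[R]_n) :
  let X w := sharp_jacobi_at (P w) (Xi w) (A w) in
  differentiable P u -> differentiable Xi u -> differentiable A u ->
  differentiable B u ->
  pairing (coord_lie_form (fun w => sharp (P w) (A w)) B u) z
  + pairing (A u) (Xi u) * pairing (coord_lie_form Xi B u) z =
  pairing ('D_(X u) B u) z + pairing (B u) ('D_z X u)
  - 'D_z (fun w => pairing (A w) (Xi w) : R^o) u * pairing (B u) (Xi u).
Proof.
move=> X dP dXi dA dB.
have dS : differentiable (fun w => sharp (P w) (A w)) u.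
  by apply: differentiable_mulmx => //; exact: differentiable_trmx.
have da := differentiable_pairing dA dXi.
have daXi := differentiable_scale da dXi.
rewrite [X in X + _ = _](pairing_coord_lie_form B z dS).
rewrite [X in _ + _ * X = _](pairing_coord_lie_form B z dXi).
have -> : 'D_(X u) B u = pairing (A u) (Xi u) *: 'D_(Xi u) B u
    + 'D_(sharp (P u) (A u)) B u.
  by rewrite -(derive_linear_dir dB) addrC.
have -> : 'D_z X u = 'D_z (fun w => sharp (P w) (A w)) u +
    ('D_z (fun w => pairing (A w) (Xi w) : R^o) u *: Xi u
     + pairing (A u) (Xi u) *: 'D_z Xi u).
  by rewrite -(derive_scale z da dXi) -(derive_addf z dS daXi).
(* Stated for arbitrary vectors, so that the algebra is done without any derivative in sight. *)
have alg (b1 b2 b : 'cV[R]_n) (s x y : 'rV[R]_n) (a d : R) :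
    pairing b1 z + pairing b s + a * (pairing b2 z + pairing b y) =
    pairing (a *: b2 + b1) z + pairing b (s + (d *: x + a *: y)) - d * pairing b x.
  by rewrite pairingDl pairingZl !pairingDr !pairingZr; ring.
exact: alg.
Qed.

Lemma ev2Br (R : realType) (n : nat) (w : 'M[R]_n) (v v1 v2 : 'rV[R]_n) :
  ev2 w v (v1 - v2) = ev2 w v v1 - ev2 w v v2.
Proof. by rewrite -!pairing_mulmx_trmx linearB mulmxBr pairingBl. Qed.

Lemma ev2_skew (R : realType) (n : nat) (w : 'M[R]_n) (v v' : 'rV[R]_n) :
  w^T = - w -> ev2 w v v' = - ev2 w v' v.
Proof.
move=> skew; rewrite /ev2 -[v *m w *m _]trmxK [_^T 0 0]mxE !trmx_mul trmxK skew.
by rewrite mulNmx mulmxN mxN00 mulmxA.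
Qed.

(** The Lie derivatives along [Xi] are absorbed into those along X and Y, at the price of the
    derivatives of a(xi) and b(xi). *)
Lemma pairing_coord_jacobi_bracket (R : realType) (n : nat)
    (P : 'rV[R]_n -> 'M[R]_n) (Xi : 'rV[R]_n -> 'rV[R]_n)
    (Th A B : 'rV[R]_n -> 'cV[R]_n) (u z : 'rV[R]_n) :
  let X w := sharp_jacobi_at (P w) (Xi w) (A w) in
  let Y w := sharp_jacobi_at (P w) (Xi w) (B w) in
  differentiable P u -> differentiable Xi u -> differentiable A u ->
  differentiable B u ->
  pairing (coord_jacobi_bracket P Xi Th A B u) z =
  (pairing ('D_(X u) B u) z + pairing (B u) ('D_z X u)
   - 'D_z (fun w => pairing (A w) (Xi w) : R^o) u * pairing (B u) (Xi u))
  - (pairing ('D_(Y u) A u) z + pairing (A u) ('D_z Y u)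
   - 'D_z (fun w => pairing (B w) (Xi w) : R^o) u * pairing (A u) (Xi u))
  - 'D_z (fun w => cev2 (P w) (A w) (B w) : R^o) u
  - pairing (A u) (Xi u) * pairing (B u) z + pairing (B u) (Xi u) * pairing (A u) z
  - cev2 (P u) (A u) (B u) * pairing (Th u) z.
Proof.
move=> X Y dP dXi dA dB.
rewrite -(pairing_lie_form_sharp z dP dXi dA dB).
rewrite -(pairing_lie_form_sharp z dP dXi dB dA).
have dc : differentiable (fun w => cev2 (P w) (A w) (B w) : R^o) u.
  apply: (differentiable_mx_entry 0 0); apply: differentiable_mulmx => //.
  by apply: differentiable_mulmx => //; exact: differentiable_trmx.
rewrite -(pairing_coord_ext_d0 z dc) /coord_jacobi_bracket.
have alg (l1 l2 d l3 l4 a b t : 'cV[R]_n) (r s c : R) :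
    pairing (l1 - l2 - d + r *: (l3 - b) - s *: (l4 - a) - c *: t) z =
    pairing l1 z + r * pairing l3 z - (pairing l2 z + s * pairing l4 z)
    - pairing d z - r * pairing b z + s * pairing a z - c * pairing t z.
  rewrite pairingBl [in LHS]pairingBl [in LHS]pairingDl !pairingZl !pairingBl.
  by ring.
exact: alg.
Qed.

(** Near [u] one has A = flat X and B = flat Y. After this substitution only [Th], [Om], X, Y and
    their first derivatives remain, and the claim is a polynomial identity modulo closedness of
    [Th], skewness of [Om] and of its derivatives, and the structure equation. *)
Lemma sharp_coord_jacobi_bracket (R : realType) (n : nat)
    (Om P : 'rV[R]_n -> 'M[R]_n) (Xi : 'rV[R]_n -> 'rV[R]_n)
    (Th A B : 'rV[R]_n -> 'cV[R]_n) (u : 'rV[R]_n) :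
  let X w := sharp_jacobi_at (P w) (Xi w) (A w) in
  let Y w := sharp_jacobi_at (P w) (Xi w) (B w) in
  differentiable Om u -> differentiable P u -> differentiable Xi u ->
  differentiable Th u -> differentiable A u -> differentiable B u ->
  (\forall w \near u, lcs_at (Om w) (Th w) (P w) (Xi w)) ->
  (forall v w, pairing ('D_v Th u) w = pairing ('D_w Th u) v) ->
  (forall v0 v1 v2, ev2 ('D_v0 Om u) v1 v2 - ev2 ('D_v1 Om u) v0 v2
     + ev2 ('D_v2 Om u) v0 v1 + wedge12 (Th u) (Om u) v0 v1 v2 = 0) ->
  sharp_jacobi_at (P u) (Xi u) (coord_jacobi_bracket P Xi Th A B u)
  = coord_bracket X Y u.
Proof.
move=> X Y dOm dP dXi dTh dA dB nlcs closed lcs.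
have dX : differentiable X u by exact: differentiable_sharp_jacobi_at.
have dY : differentiable Y u by exact: differentiable_sharp_jacobi_at.
have lcsu := nbhs_singleton nlcs.
have AE : \forall w \near u, A w = flat_jacobi (Om w) (Th w) (X w).
  by apply: filterS nlcs => w h; rewrite (sharp_jacobiK h).
have BE : \forall w \near u, B w = flat_jacobi (Om w) (Th w) (Y w).
  by apply: filterS nlcs => w h; rewrite (sharp_jacobiK h).
have dpair (Z : 'rV[R]_n -> 'rV[R]_n) : differentiable Z u -> forall z,
    'D_z (fun w => - pairing (Th w) (Z w) : R^o) u =
    - (pairing ('D_z Th u) (Z u) + pairing (Th u) ('D_z Z u)).
  move=> dZ z; rewrite -(derive_pairing z dTh dZ); apply: deriveN.
  by apply: diff_derivable; exact: differentiable_pairing.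
have aE z : 'D_z (fun w => pairing (A w) (Xi w) : R^o) u =
    - (pairing ('D_z Th u) (X u) + pairing (Th u) ('D_z X u)).
  rewrite -(dpair X dX); apply: near_eq_derive.
  by apply: filterS nlcs => w h; exact: (pairing_xi (A w) h).
have bE z : 'D_z (fun w => pairing (B w) (Xi w) : R^o) u =
    - (pairing ('D_z Th u) (Y u) + pairing (Th u) ('D_z Y u)).
  rewrite -(dpair Y dY); apply: near_eq_derive.
  by apply: filterS nlcs => w h; exact: (pairing_xi (B w) h).
have cE z : 'D_z (fun w => cev2 (P w) (A w) (B w) : R^o) u =
    ev2 ('D_z Om u) (X u) (Y u) + ev2 (Om u) ('D_z X u) (Y u)
    + ev2 (Om u) (X u) ('D_z Y u).
  rewrite -(derive_ev2 z dOm dX dY); apply: near_eq_derive.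
  by apply: filterS nlcs => w h; exact: (cev2_ev2 (A w) (B w) h).
have DA v z : pairing ('D_v A u) z =
    (pairing ('D_v Th u) (X u) + pairing (Th u) ('D_v X u)) * pairing (Th u) z
    + pairing (Th u) (X u) * pairing ('D_v Th u) z
    + ev2 ('D_v Om u) z (X u) + ev2 (Om u) z ('D_v X u).
  by rewrite (near_eq_derive v AE) -(derive_flat_jacobi v z dOm dTh dX).
have DB v z : pairing ('D_v B u) z =
    (pairing ('D_v Th u) (Y u) + pairing (Th u) ('D_v Y u)) * pairing (Th u) z
    + pairing (Th u) (Y u) * pairing ('D_v Th u) z
    + ev2 ('D_v Om u) z (Y u) + ev2 (Om u) z ('D_v Y u).
  by rewrite (near_eq_derive v BE) -(derive_flat_jacobi v z dOm dTh dY).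
have skew := lcs_at_skew lcsu.
have Dskew v : ('D_v Om u)^T = - 'D_v Om u.
  rewrite -(derive_trmx v dOm) -deriveN; last exact: diff_derivable.
  by apply: near_eq_derive; apply: filterS nlcs => w [].
(* The comparison moves to 1-forms: the Jacobi bracket has to equal flat of [X, Y]. *)
rewrite -[RHS](flat_jacobiK lcsu); congr sharp_jacobi_at.
apply: pairing_inj => z.
rewrite (pairing_coord_jacobi_bracket Th z dP dXi dA dB) -/X -/Y.
rewrite [in RHS]pairing_flat /coord_bracket pairingBr ev2Br.
rewrite aE bE cE (pairing_xi (A u) lcsu) (pairing_xi (B u) lcsu) DA DB.
rewrite (cev2_ev2 (A u) (B u) lcsu) -/(X u) -/(Y u).
rewrite (nbhs_singleton AE) (nbhs_singleton BE) !pairing_flat.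
(* [Xz] and [Xy] stand for the derivatives of X along [z] and Y, [Yz] and [Yx] for those of Y along
   [z] and X; the first argument of [dth] and [dom] is the direction of differentiation. *)
have alg (th : 'rV[R]_n -> R) (dth om : 'rV[R]_n -> 'rV[R]_n -> R)
    (dom : 'rV[R]_n -> 'rV[R]_n -> 'rV[R]_n -> R) (x y Xz Yz Xy Yx : 'rV[R]_n) :
  (forall v w, dth v w = dth w v) -> (forall v w, om v w = - om w v) ->
  (forall t v w, dom t v w = - dom t w v) ->
  dom x y z - dom y x z + dom z x y
    + (th x * om y z - th y * om x z + th z * om x y) = 0 ->
  (dth x y + th Yx) * th z + th y * dth x z + dom x z y + om z Yx
  + (th y * th Xz + om Xz y) - - (dth z x + th Xz) * - th y
  - ((dth y x + th Xy) * th z + th x * dth y z + dom y z x + om z Xy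
     + (th x * th Yz + om Yz x) - - (dth z y + th Yz) * - th x)
  - (dom z x y + om Xz y + om x Yz) - - th x * (th y * th z + om z y)
  + - th y * (th x * th z + om z x) - om x y * th z =
  (th Yx - th Xy) * th z + (om z Yx - om z Xy).
  move=> dthC omN domN lcs0.
  (* These instances bring both sides to common atoms; their difference is then minus the left-hand
     side of the structure equation at (x, y, z). *)
  rewrite (dthC x y) (dthC z x) (dthC z y) (omN Yz x) (omN z y) (omN z x).
  rewrite (domN x z y) (domN y z x); apply/eqP; rewrite -subr_eq0.
  by apply/eqP; rewrite -[RHS]oppr0 -[in RHS]lcs0; ring.
apply: (alg (pairing (Th u)) (fun v => pairing ('D_v Th u)) (ev2 (Om u))
  (fun v => ev2 ('D_v Om u))).
- exact: closed.
- by move=> v w; exact: ev2_skew.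
- by move=> t v w; apply: ev2_skew; exact: Dskew.
- exact: lcs.
Qed.

(** * The isomorphism *)

Lemma v2comp_at (R : realType) (n : nat) (M : manifold R n)
    (p : M -> 'M[R]_n) (x : M) : v2comp (chart_at x) p x = p x.
Proof.
by rewrite /v2comp jac_id ?trmx1 ?mulmx1 ?mul1mx //; exact: dom_chart_at.
Qed.

Lemma jac_at_K (R : realType) (n : nat) (M : manifold R n) (i : chart M) (x : M) :
  dom i x -> jac (chart_at x) i x *m jac i (chart_at x) x = 1%:M.
Proof. by move=> ix; rewrite jacK //; exact: dom_chart_at. Qed.

Lemma jac_at_VK (R : realType) (n : nat) (M : manifold R n) (i : chart M) (x : M) :
  dom i x -> jac i (chart_at x) x *m jac (chart_at x) i x = 1%:M.
Proof. by move=> ix; rewrite jacK //; exact: dom_chart_at. Qed.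

Lemma pairing_comp (R : realType) (n : nat) (M : manifold R n) (i : chart M)
    (a : M -> 'cV[R]_n) (X : M -> 'rV[R]_n) (x : M) : dom i x ->
  pairing (fcomp i a x) (vcomp i X x) = pairing (a x) (X x).
Proof.
move=> ix; rewrite /pairing /fcomp /vcomp; have := jac_at_K ix.
move: (jac (chart_at x) i x) (jac i (chart_at x) x) => K J KJ.
by rewrite mulmxA -[X x *m K *m J]mulmxA KJ mulmx1.
Qed.

Lemma vcomp_sharp (R : realType) (n : nat) (M : manifold R n) (i : chart M)
    (p : M -> 'M[R]_n) (a : M -> 'cV[R]_n) (x : M) : dom i x ->
  vcomp i (fun y => sharp (p y) (a y)) x = sharp (v2comp i p x) (fcomp i a x).
Proof.
move=> ix; rewrite /sharp /fcomp /vcomp /v2comp; have := jac_at_K ix.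
move: (jac (chart_at x) i x) (jac i (chart_at x) x) => K J KJ.
by rewrite !mulmxA -trmx_mul mulmxA KJ mul1mx.
Qed.

Lemma cev2_comp (R : realType) (n : nat) (M : manifold R n) (i : chart M)
    (p : M -> 'M[R]_n) (a b : M -> 'cV[R]_n) (x : M) : dom i x ->
  cev2 (v2comp i p x) (fcomp i a x) (fcomp i b x) = cev2 (p x) (a x) (b x).
Proof.
move=> ix; rewrite -!pairing_sharp -(vcomp_sharp p a ix).
exact: (pairing_comp b (fun y => sharp (p y) (a y)) ix).
Qed.

Lemma vcomp_sharp_jacobi (R : realType) (n : nat) (M : manifold R n)
    (i : chart M) (p : M -> 'M[R]_n) (xi : M -> 'rV[R]_n) (a : M -> 'cV[R]_n)
    (x : M) : dom i x ->
  vcomp i (fun y => sharp_jacobi p xi y (a y)) x =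
  sharp_jacobi_at (v2comp i p x) (vcomp i xi x) (fcomp i a x).
Proof.
move=> ix; rewrite /sharp_jacobi_at -(vcomp_sharp p a ix) (pairing_comp a xi ix).
by rewrite /vcomp /sharp_jacobi mulmxDl scalemxAl.
Qed.

(** Forms change by [J] and multivectors by its inverse [K], so each contraction meets a factor
    [K *m J] that disappears. *)
Lemma lcs_at_change (R : realType) (n : nat) (om p J K : 'M[R]_n)
    (th : 'cV[R]_n) (xi : 'rV[R]_n) : K *m J = 1%:M -> J *m K = 1%:M ->
  lcs_at om th p xi ->
  lcs_at (J *m om *m J^T) (J *m th) (K^T *m p *m K) (xi *m K).
Proof.
move=> KJ JK h; split.
- by rewrite !trmx_mul trmxK (lcs_at_skew h) mulNmx mulmxN mulmxA.
- have -> : K^T *m p *m K *m (J *m om *m J^T) = K^T *m (p *m (K *m J) *m om) *m J^T.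
    by rewrite !mulmxA.
  by rewrite KJ mulmx1 (lcs_at_inv h) mulmxN mulmx1 mulNmx -trmx_mul JK trmx1.
- have -> : xi *m K *m (J *m om *m J^T) = xi *m (K *m J) *m om *m J^T.
    by rewrite !mulmxA.
  by rewrite KJ mulmx1 (lcs_at_xi h) mulNmx -trmx_mul.
Qed.

Lemma lcs_at_point (R : realType) (n : nat) (M : manifold R n)
    (omega : M -> 'M[R]_n) (theta : M -> 'cV[R]_n)
    (p : M -> 'M[R]_n) (xi : M -> 'rV[R]_n) (x : M) :
  is_lcs omega theta -> is_assoc_jacobi omega theta p xi ->
  lcs_at (omega x) (theta x) (p x) (xi x).
Proof.
move=> [[alt _] _ _ _ _] [_ _ pE xiE]; split.
- exact: ev2_alternating_trmx.
- apply: mulmx_rV_inj => r; apply: trmx_inj; apply: pairing_inj => v.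
  have := pE x r^T v; rewrite /ev2 /sharp trmxK => E.
  rewrite pairing_trmx trmxK mulmxA E pairing_trmx trmxK.
  by rewrite [RHS]pairing_trmx trmxK mulmxN mulmx1 mulNmx mxN00.
- apply: trmx_inj; apply: pairing_inj => v.
  have := xiE x v; rewrite /ev2 => E.
  by rewrite pairing_trmx trmxK E pairing_trmx [RHS]pairing_trmx trmxK mulNmx mxN00.
Qed.

Lemma lcs_at_chart (R : realType) (n : nat) (M : manifold R n)
    (omega : M -> 'M[R]_n) (theta : M -> 'cV[R]_n)
    (p : M -> 'M[R]_n) (xi : M -> 'rV[R]_n) (i : chart M) (x : M) :
  is_lcs omega theta -> is_assoc_jacobi omega theta p xi -> dom i x ->
  lcs_at (f2comp i omega x) (fcomp i theta x) (v2comp i p x) (vcomp i xi x).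
Proof.
move=> hlcs hjac ix; apply: lcs_at_change; [exact: jac_at_K|exact: jac_at_VK|].
exact: lcs_at_point.
Qed.

(** * The brackets in the preferred chart *)

Lemma lie_formE (R : realType) (n : nat) (M : manifold R n)
    (X : M -> 'rV[R]_n) (b : M -> 'cV[R]_n) (x : M) :
  let c := chart_at x in
  lie_form X b x = coord_lie_form (vcomp c X \o chartV c) (fcomp c b \o chartV c)
    (chart_map c x).
Proof.
move=> c; have cx := @dom_chart_at _ _ M x.
have X0 : (vcomp c X \o chartV c) (chart_map c x) = X x.
  by rewrite /comp (chart_mapK cx) vcomp_at.
have b0 : (fcomp c b \o chartV c) (chart_map c x) = b x.
  by rewrite /comp (chart_mapK cx) fcomp_at.
by rewrite /coord_lie_form X0 b0.
Qed.

Lemma coord_lie_form_near_eq (R : realType) (n : nat)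
    (X X' : 'rV[R]_n -> 'rV[R]_n) (b : 'rV[R]_n -> 'cV[R]_n) (u : 'rV[R]_n) :
  (\forall w \near u, X w = X' w) ->
  coord_lie_form X b u = coord_lie_form X' b u.
Proof.
move=> XX; rewrite /coord_lie_form (nbhs_singleton XX); congr (_ + _).
by apply/colP => k; rewrite !mxE (near_eq_derive _ XX).
Qed.

(** The inner terms sharp(a) and p(a, b) are evaluated at y near [x] with components in the chart at
    y; naturality of both operations moves them to the chart at [x]. *)
Lemma bracket_jacobiE (R : realType) (n : nat) (M : manifold R n)
    (p : M -> 'M[R]_n) (xi : M -> 'rV[R]_n) (lambda a b : M -> 'cV[R]_n)
    (x : M) :
  let c := chart_at x in
  bracket_jacobi p xi lambda a b x =
  coord_jacobi_bracket (v2comp c p \o chartV c) (vcomp c xi \o chartV c)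
    (fcomp c lambda \o chartV c) (fcomp c a \o chartV c) (fcomp c b \o chartV c)
    (chart_map c x).
Proof.
move=> c; have cx : dom c x by exact: dom_chart_at.
have near_c := near_chart openT I cx.
have lieE (a' b' : M -> 'cV[R]_n) :
    lie_form (fun y => sharp (p y) (a' y)) b' x =
    coord_lie_form (fun w => sharp ((v2comp c p \o chartV c) w)
      ((fcomp c a' \o chartV c) w)) (fcomp c b' \o chartV c) (chart_map c x).
  rewrite lie_formE; apply: coord_lie_form_near_eq.
  by apply: filterS near_c => w [_ cw _]; exact: vcomp_sharp.
have d0E : ext_d0 (fun y => cev2 (p y) (a y) (b y)) x =
    coord_ext_d0 (fun w => cev2 ((v2comp c p \o chartV c) w)
      ((fcomp c a \o chartV c) w) ((fcomp c b \o chartV c) w)) (chart_map c x).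
  apply/colP => k; rewrite !mxE; apply: near_eq_derive.
  by apply: filterS near_c => w [_ cw _]; exact/esym/cev2_comp.
rewrite /bracket_jacobi /bracket_bivector /coord_jacobi_bracket.
rewrite (lieE a b) (lieE b a) d0E !lie_formE -/c.
by rewrite /comp (chart_mapK cx) !fcomp_at vcomp_at v2comp_at.
Qed.

Lemma form1_chart (R : realType) (n : nat) (M : manifold R n)
    (a : M -> 'cV[R]_n) (i : chart M) : form1 a ->
  msmooth_on (dom i) (fcomp i a).
Proof.
move=> sa; have oi := @open_dom _ _ M i.
apply: (msmooth_on_eq oi _ (msmooth_on_trmx oi (sa i))) => x _.
by rewrite /= trmxK.
Qed.

Lemma msmooth_on_differentiable (R : realType) (n : nat) (M : manifold R n)
    (W : normedModType R) (U : set M) (f : M -> W) (i : chart M) (x : M) :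
  msmooth_on U f -> U x -> dom i x ->
  differentiable (f \o chartV i) (chart_map i x).
Proof. by move=> Uf Ux ix; apply: smooth_on_differentiable (Uf i) _; exists x. Qed.

Lemma sharp_bracket_jacobi (R : realType) (n : nat) (M : manifold R n)
    (omega : M -> 'M[R]_n) (theta : M -> 'cV[R]_n)
    (p : M -> 'M[R]_n) (xi : M -> 'rV[R]_n) (a b : M -> 'cV[R]_n) (x : M) :
  is_lcs omega theta -> is_assoc_jacobi omega theta p xi ->
  form1 a -> form1 b ->
  sharp_jacobi p xi x (bracket_jacobi p xi theta a b x) =
  lie_bracket (fun y => sharp_jacobi p xi y (a y))
    (fun y => sharp_jacobi p xi y (b y)) x.
Proof.
move=> hlcs hjac sa sb.
have [[_ som] _ sth closed dlcs] := hlcs; have [[_ sp] sxi _ _] := hjac.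
have cx := @dom_chart_at _ _ M x; set c := chart_at x in cx *.
have near_c := near_chart openT I cx.
have sharpE (a' : M -> 'cV[R]_n) : \forall w \near chart_map c x,
    (vcomp c (fun y => sharp_jacobi p xi y (a' y)) \o chartV c) w =
    sharp_jacobi_at ((v2comp c p \o chartV c) w) ((vcomp c xi \o chartV c) w)
      ((fcomp c a' \o chartV c) w).
  by apply: filterS near_c => w [_ cw _]; exact: vcomp_sharp_jacobi.
rewrite lie_bracketE (coord_bracket_near_eq (sharpE a) (sharpE b)).
have om0 : (f2comp c omega \o chartV c) (chart_map c x) = omega x.
  by rewrite /comp (chart_mapK cx) f2comp_at.
have th0 : (fcomp c theta \o chartV c) (chart_map c x) = theta x.
  by rewrite /comp (chart_mapK cx) fcomp_at.
have p0 : (v2comp c p \o chartV c) (chart_map c x) = p x.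
  by rewrite /comp (chart_mapK cx) v2comp_at.
have xi0 : (vcomp c xi \o chartV c) (chart_map c x) = xi x.
  by rewrite /comp (chart_mapK cx) vcomp_at.
rewrite -(sharp_coord_jacobi_bracket (Om := f2comp c omega \o chartV c)
  (Th := fcomp c theta \o chartV c)).
- by rewrite p0 xi0 bracket_jacobiE.
- exact: (msmooth_on_differentiable (som c) cx cx).
- exact: (msmooth_on_differentiable (sp c) cx cx).
- exact: (msmooth_on_differentiable (sxi c) cx cx).
- exact: (msmooth_on_differentiable (form1_chart c sth) cx cx).
- exact: (msmooth_on_differentiable (form1_chart c sa) cx cx).
- exact: (msmooth_on_differentiable (form1_chart c sb) cx cx).
- by apply: filterS near_c => w [_ cw _]; exact: lcs_at_chart.
- by move=> v w; apply/eqP; rewrite -subr_eq0; apply/eqP; exact: closed.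
- by move=> v0 v1 v2; rewrite om0 th0; exact: dlcs.
Qed.

Lemma sharp_jacobi_morphism (R : realType) (n : nat) (M : manifold R n)
    (p : M -> 'M[R]_n) (xi : M -> 'rV[R]_n) :
  bivector_field p -> vector_field xi ->
  @vb_morphism R n M (cotangent M) (tangent M) (sharp_jacobi p xi).
Proof.
move=> [_ sp] sxi; split=> [x c a b|t s] /=.
  rewrite /sharp_jacobi /sharp linearP mulmxDl -scalemxAl pairing_linearl.
  by rewrite scalerDl scalerDr !scalerA addrACA.
(* In one chart the anchor multiplies the row of a covector by p + xi^T xi; the Jacobian then passes
   from chart [t] to chart [s]. *)
exists (fun x => (v2comp t p x + (vcomp t xi x)^T *m vcomp t xi x) *m jac t s x).
  have o : open (dom t `&` dom s) by apply: openI; exact: open_dom.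
  have xit : msmooth_on (dom t `&` dom s) (vcomp t xi).
    by apply: msmooth_on_sub (sxi t) => x [].
  apply: (msmooth_on_mulmx o); last exact: msmooth_jac.
  apply: (msmooth_onD o); first by apply: msmooth_on_sub (sp t) => x [].
  exact: (msmooth_on_mulmx o (msmooth_on_trmx o xit) xit).
move=> x e tx sx.
have E := vcomp_change (fun y => sharp_jacobi p xi y e) tx sx.
apply: (etrans E); rewrite mulmxA; congr (_ *m _).
rewrite (vcomp_sharp_jacobi p xi (fun=> e) tx) /sharp_jacobi_at /sharp mulmxDr.
congr (_ + _); rewrite pairingZ_rV mulmxA; congr (_ *m _).
by rewrite -trmx_mul; apply/matrixP => i j; rewrite !ord1 [RHS]mxE.
Qed.

Lemma flat_jacobi_morphism (R : realType) (n : nat) (M : manifold R n)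
    (omega : M -> 'M[R]_n) (theta : M -> 'cV[R]_n) :
  form2 omega -> form1 theta ->
  @vb_morphism R n M (tangent M) (cotangent M)
    (fun x => flat_jacobi (omega x) (theta x)).
Proof.
move=> [_ som] sth.
(* As a single matrix, flat is theta theta^T + omega; its transpose appears below because the
   cotangent trivialization is a row. *)
have flatE x v : flat_jacobi (omega x) (theta x) v =
    (theta x *m (theta x)^T + omega x) *m v^T.
  rewrite /flat_jacobi pairingZ_cV mulmxDl -mulmxA; congr (_ *m _ + _).
  by rewrite -trmx_mul; apply/matrixP => i j; rewrite !ord1 [RHS]mxE.
split=> [x c v w|t s] /=.
  by rewrite !flatE linearP mulmxDr -scalemxAr.
exists (fun x => (fcomp t theta x *m (fcomp t theta x)^T + f2comp t omega x)^T
    *m (jac s t x)^T).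
  have o : open (dom t `&` dom s) by apply: openI; exact: open_dom.
  have tht : msmooth_on (dom t `&` dom s) (fcomp t theta).
    by apply: msmooth_on_sub (form1_chart t sth) => x [].
  apply: (msmooth_on_mulmx o).
    apply: (msmooth_on_trmx o); apply: (msmooth_onD o).
      exact: (msmooth_on_mulmx o tht (msmooth_on_trmx o tht)).
    by apply: msmooth_on_sub (som t) => x [].
  apply: (msmooth_on_trmx o); rewrite setIC; exact: msmooth_jac.
move=> x v tx sx; have cx := @dom_chart_at _ _ M x.
rewrite flatE /fcomp /f2comp.
have sc : jac s (chart_at x) x = jac s t x *m jac t (chart_at x) x.
  by rewrite jac_mul.
have ct := jac_at_K tx.
rewrite sc; move: (jac s t x) (jac t (chart_at x) x) (jac (chart_at x) t x) ct.
move=> S T K KT.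
have -> : T *m theta x *m (T *m theta x)^T + T *m omega x *m T^T =
    T *m (theta x *m (theta x)^T + omega x) *m T^T.
  by rewrite trmx_mul mulmxDr mulmxDl !mulmxA.
move: (_ + omega x) => G; rewrite !trmx_mul !trmxK !mulmxA; congr (_ *m _ *m _ *m _).
by rewrite -mulmxA KT mulmx1.
Qed.

Theorem proposition1p6 (R : realType) (n : nat) (M : manifold R n)
    (omega : M -> 'M[R]_n) (theta : M -> 'cV[R]_n)
    (p : M -> 'M[R]_n) (xi : M -> 'rV[R]_n)
    (hlcs : is_lcs omega theta)
    (hjac : is_assoc_jacobi omega theta p xi) :
  is_lie_algebroid (jacobi_algebroid p xi theta) /\
  algebroid_iso (jacobi_algebroid p xi theta) (tangent_algebroid M).
Proof.
have [som _ sth _ _] := hlcs; have [sp sxi _ _] := hjac.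
have sharpm := sharp_jacobi_morphism sp sxi.
have iso : algebroid_iso (jacobi_algebroid p xi theta) (tangent_algebroid M).
  exists (sharp_jacobi p xi), (fun x => flat_jacobi (omega x) (theta x)); split.
  - exact: sharpm.
  - exact: flat_jacobi_morphism.
  - move=> x; have h := lcs_at_point x hlcs hjac.
    by split; [exact: (sharp_jacobiK h)|exact: (flat_jacobiK h)].
  (* The anchor of the tangent algebroid is the identity and the isomorphism is the Jacobi anchor
     itself, so anchors match by definition. *)
  - by [].
  - by move=> a b sa sb x; exact: (sharp_bracket_jacobi x hlcs hjac).
split=> //; apply: lie_algebroid_iso iso (tangent_lie_algebroid M).
  exact: is_vbundle_cotangent.
exact: sharpm.
Qed.
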